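(* Let $n\ge 1$, $N:=2^n$, and consider the $n$-qubit bilinear control system $\Sigma_b$ $$\dot\rho(t) = -\big(i\hat H_u(t) + \gamma(t)\,\Gamma_b\big)\rho(t),\qquad \rho(0)=\rho_0,$$ where $H_u(t)=H_0+\sum_{j=1}^m u_j(t)H_j$ with Hermitian $H_0,H_1,\dots,H_m$ on $(\mathbb C^2)^{\otimes n}$, real piecewise-constant (not necessarily bounded) control amplitudes $u_j(t)$, $\hat H(\rho):=[H,\rho]$, and $$\Gamma_b(\rho) := -\Big(V_b\rho V_b^\dagger - \tfrac12\big(V_b^\dagger V_b\rho+\rho V_b^\dagger V_b\big)\Big),\qquad V_b:=\mathbb 1_2^{\otimes(n-1)}\otimes X/\sqrt2,$$ with $X$ the Pauli $x$ matrix, i.e. bit-flip relaxation on the $n$-th qubit, whose noise amplitude is a piecewise-constant control switchable between two values, $\gamma(t)\in\{0,\gamma_*\}$ with a fixed $\gamma_*>0$. Assume there are no further sources of decoherence, and that $$\langle iH_0, iH_1,\dots,iH_m\rangle_{\mathrm{Lie}} = \mathfrak{su}(N).$$ Then for every density operator $\rho_0\in\mathfrak{pos}_1$, in the limit $\gamma_*\tau\to\infty$, $$\overline{\mathfrak{reach}_{\Sigma_b}(\rho_0)} = \{\rho\in\mathfrak{pos}_1 \,:\, \rho\prec\rho_0\}.$$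
   Context: $\mathfrak{pos}_1$ denotes the set of all density operators on $(\mathbb C^2)^{\otimes n}$. $\langle\cdot\rangle_{\mathrm{Lie}}$ denotes the generated Lie algebra. The reachable set $\mathfrak{reach}_{\Sigma_b}(\rho_0)$ is the set of all states $\rho(\tau)$, $\tau\ge0$, obtainable from $\rho_0$ by solutions of the control system for some admissible controls; its closure is understood as the asymptotic limit $\gamma_*\tau\to\infty$ of the total control duration $\tau$. For density operators, $\rho\prec\rho_0$ ($\rho$ is majorised by $\rho_0$) means that the vector of eigenvalues of $\rho$ is majorised by that of $\rho_0$: with eigenvalues sorted decreasingly, all partial sums of those of $\rho$ are $\le$ the corresponding partial sums of those of $\rho_0$ (total sums are equal). *)

(* Defs.v *)
From HB Require Import structures.
From mathcomp Require Import all_boot all_order all_algebra.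
From mathcomp Require Import all_classical all_reals all_analysis.
From mathcomp Require Export complex.
Import Order.TTheory GRing.Theory Num.Theory numFieldNormedType.Exports.

Set Implicit Arguments.
Unset Strict Implicit.
Unset Printing Implicit Defensive.

Local Open Scope ring_scope.
Local Open Scope complex_scope.

Section QuantumControl.
Variable R : realType.
Local Notation C := R[i].

Definition iu : C := Complex 0 1.

Definition dagger (p q : nat) (A : 'M[C]_(p, q)) : 'M[C]_(q, p) :=
  (map_mx (@conjc R) A)^T.

Definition is_hermitian (N : nat) (A : 'M[C]_N) : Prop := dagger A = A.

Definition is_psd (N : nat) (A : 'M[C]_N) : Prop :=
  forall v : 'cV[C]_N, 0 <= (dagger v *m A *m v) 0 0.

Definition is_density (N : nat) (A : 'M[C]_N) : Prop :=
  [/\ is_hermitian A, is_psd A & \tr A = 1].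

Definition lie_bracket (N : nat) (A B : 'M[C]_N) : 'M[C]_N := A *m B - B *m A.

Definition lie_subalgebra (N : nat) (S : 'M[C]_N -> Prop) : Prop :=
  [/\ S 0,
      (forall A B, S A -> S B -> S (A + B)),
      (forall (r : R) A, S A -> S (r%:C *: A)) &
      (forall A B, S A -> S B -> S (lie_bracket A B))].

Definition lie_generated (N : nat) (G : 'M[C]_N -> Prop) (A : 'M[C]_N) : Prop :=
  forall S, lie_subalgebra S -> (forall B, G B -> S B) -> S A.

Definition in_su (N : nat) (A : 'M[C]_N) : Prop := dagger A = - A /\ \tr A = 0.

(* V_b = 1_2^{(n-1)} (x) X / sqrt 2, written entrywise in the standard
   Kronecker ordering: index i = 2a + b with b the n-th (last) qubit. *)
Definition Vb (n : nat) : 'M[C]_(2 ^ n) :=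
  \matrix_(i, j) if (i./2 == j./2)%N && (odd i != odd j)
                 then ((Num.sqrt (2 : R))^-1)%:C else 0.

Definition Gamma_b (n : nat) (rho : 'M[C]_(2 ^ n)) : 'M[C]_(2 ^ n) :=
  - (Vb n *m rho *m dagger (Vb n)
     - (2 : C)^-1 *: (dagger (Vb n) *m Vb n *m rho + rho *m (dagger (Vb n) *m Vb n))).

Definition Hu (n m : nat) (H0 : 'M[C]_(2 ^ n)) (H : 'I_m -> 'M[C]_(2 ^ n))
  (u : 'I_m -> R) : 'M[C]_(2 ^ n) :=
  H0 + \sum_(j < m) (u j)%:C *: H j.

Definition lindblad_gen (n m : nat) (H0 : 'M[C]_(2 ^ n)) (H : 'I_m -> 'M[C]_(2 ^ n))
  (u : 'I_m -> R) (gamma : R) (rho : 'M[C]_(2 ^ n)) : 'M[C]_(2 ^ n) :=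
  - (iu *: lie_bracket (Hu H0 H u) rho + gamma%:C *: Gamma_b rho).

Definition solves_on (N : nat) (L : 'M[C]_N -> 'M[C]_N) (f : R -> 'M[C]_N)
  (a b : R) : Prop :=
  forall i j : 'I_N,
    {within `[a, b], continuous (fun s => @complex.Re R (f s i j))}%classic /\
    {within `[a, b], continuous (fun s => @complex.Im R (f s i j))}%classic /\
    (forall t, a < t < b ->
       is_derive t (1 : R) (fun s => @complex.Re R (f s i j)) (@complex.Re R (L (f t) i j)) /\
       is_derive t (1 : R) (fun s => @complex.Im R (f s i j)) (@complex.Im R (L (f t) i j))).

(* A piecewise-constant admissible control: a finite list of pieces
   (duration d >= 0, amplitudes u : 'I_m -> R, switch g); on a ctrl_piece the noise
   amplitude is gamma_* if g = true and 0 if g = false. *)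
Definition ctrl_piece (m : nat) : Type := (R * ('I_m -> R) * bool)%type.

Definition start_time (m : nat) (ps : seq (ctrl_piece m)) (k : nat) : R :=
  \sum_(l < k) (nth (0, fun _ => 0, false) ps l).1.1.

Definition reach_set (n m : nat) (H0 : 'M[C]_(2 ^ n)) (H : 'I_m -> 'M[C]_(2 ^ n))
  (gstar : R) (rho0 rho : 'M[C]_(2 ^ n)) : Prop :=
  exists (ps : seq (ctrl_piece m)) (f : R -> 'M[C]_(2 ^ n)),
    [/\ (forall k : nat, (k < size ps)%N -> 0 <= (nth (0, fun _ => 0, false) ps k).1.1),
        f 0 = rho0,
        f (start_time ps (size ps)) = rho &
        (forall k : nat, (k < size ps)%N ->
           let p := nth (0, fun _ => 0, false) ps k in
           solves_on (lindblad_gen H0 H p.1.2 (if p.2 then gstar else 0))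
                     f (start_time ps k) (start_time ps k.+1))].

Definition mx_closure (N : nat) (S : 'M[C]_N -> Prop) (A : 'M[C]_N) : Prop :=
  forall e : R, 0 < e -> exists B, S B /\ forall i j, `|A i j - B i j| < e%:C.

Definition eigvals_of (N : nat) (A : 'M[C]_N) (s : seq R) : Prop :=
  char_poly A = \prod_(x <- s) ('X - (x%:C)%:P).

Definition majorized_by (N : nat) (rho rho0 : 'M[C]_N) : Prop :=
  exists s s0 : seq R,
    [/\ eigvals_of rho s /\ eigvals_of rho0 s0,
        sorted (fun x y => y <= x) s, sorted (fun x y => y <= x) s0,
        (forall k, (k <= N)%N -> \sum_(l < k) s`_l <= \sum_(l < k) s0`_l) &
        \sum_(l < N) s`_l = \sum_(l < N) s0`_l].

End QuantumControl.

(* Main.v *)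
(** Both inclusions work with one-parameter semigroups [flow L t = exp (t L)] of linear maps on
    matrices that contract the Hilbert-Schmidt norm, and with the tangent cone of a closed
    semigroup SS of nonexpansive maps: L is tangent to SS if SS contains maps that agree with
    1 + h L up to o(h).  The tangent cone is a closed convex cone, and an Euler scheme, whose
    local errors add up because every step is nonexpansive, puts [flow L t] into SS for each
    dissipative tangent L.

    Lower bound.  Let SS be the closure of the maps reached by admissible controls.  With the
    noise off, the flows are isometries of a finite dimensional space, so by the pigeonhole
    principle their powers return close to the identity and SS contains their inverses.  Hence
    the A for which both ad A and - ad A are tangent form a Lie algebra, which is all of su(N)
    by hypothesis, and SS contains every conjugation by a unitary.  Subtracting the drift from
    the noisy generator leaves pure bit-flip noise, which mixes x with X x X.  Every traceless
    reflection Q is unitarily similar to X, so the mixing of x with Q x Q is also in SS, and for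
    Q exchanging two basis vectors and diagonal on the others this is a T-transform of the
    eigenvalues.  T-transforms reach every majorized spectrum.

    Upper bound.  The operators whose Ky Fan sums are bounded by those of rho0 form an
    intersection of a unitarily invariant family of half-spaces.  The maps that preserve it form
    a closed semigroup to which the Hamiltonian part and the noise part of the generator are
    tangent, hence so is their sum. *)
Require Import Defs.
From HB Require Import structures.
From mathcomp Require Import all_boot all_order all_algebra.
From mathcomp Require Import all_classical all_reals all_analysis.
From mathcomp Require Import complex.
From mathcomp Require Import spectral fingroup perm ring lra zify.
Import Order.TTheory GRing.Theory Num.Theory numFieldNormedType.Exports.
Local Open Scope ring_scope.
Local Open Scope complex_scope.

Set Implicit Arguments.
Unset Strict Implicit.
Unset Printing Implicit Defensive.

(** * Real Hilbert-Schmidt geometry of complex matrices *)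

Definition ip (R : realType) (N : nat) (x y : 'M[R[i]]_N) : R :=
  complex.Re (\tr (dagger x *m y)).

(** Locked, so that simplification treats the norm as an atom; [nrmE] opens it. *)
HB.lock Definition nrm (R : realType) (N : nat) (x : 'M[R[i]]_N) : R := Num.sqrt (ip x x).
Canonical nrm_unlockable := Unlockable nrm.unlock.

Section HilbertSchmidt.
Variables (R : realType) (N : nat).
Local Notation C := R[i].
Local Notation E := 'M[C]_N.
Local Notation Re := (@complex.Re R).
Local Notation Im := (@complex.Im R).

Lemma Re_add (x y : C) : Re (x + y) = Re x + Re y. Proof. by case: x y => ? ? []. Qed.
Lemma Im_add (x y : C) : Im (x + y) = Im x + Im y. Proof. by case: x y => ? ? []. Qed.
Lemma Re_opp (x : C) : Re (- x) = - Re x. Proof. by case: x. Qed.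
Lemma Im_opp (x : C) : Im (- x) = - Im x. Proof. by case: x. Qed.
Lemma Re_mul (x y : C) : Re (x * y) = Re x * Re y - Im x * Im y.
Proof. by case: x y => ? ? []. Qed.
Lemma Im_mul (x y : C) : Im (x * y) = Re x * Im y + Im x * Re y.
Proof. by case: x y => ? ? []. Qed.
Lemma Re_sum I (r : seq I) (P : pred I) (F : I -> C) :
  Re (\sum_(i <- r | P i) F i) = \sum_(i <- r | P i) Re (F i).
Proof. by apply: (big_morph Re Re_add). Qed.
Lemma complex_eqP (x y : C) : Re x = Re y -> Im x = Im y -> x = y.
Proof. by case: x y => ? ? [] ? ? /= -> ->. Qed.
Lemma Re_conjc (x : C) : Re (x^*)%C = Re x. Proof. by case: x. Qed.
Lemma Im_conjc (x : C) : Im (x^*)%C = - Im x. Proof. by case: x. Qed.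

Definition modc (z : C) : R := Num.sqrt (Re z ^+ 2 + Im z ^+ 2).

Lemma normE (z : C) : `|z| = (modc z)%:C. Proof. exact: normc_def. Qed.

Lemma modc_ge0 z : 0 <= modc z. Proof. exact: sqrtr_ge0. Qed.

Lemma modc_le (z : C) : modc z <= `|Re z| + `|Im z|.
Proof.
rewrite /modc -(@ler_pXn2r _ 2) ?nnegrE ?sqrtr_ge0 ?addr_ge0 //.
rewrite sqr_sqrtr ?addr_ge0 ?sqr_ge0 //.
rewrite sqrrD !real_normK ?num_real // lerD2r lerDl.
by rewrite mulrn_wge0 // mulr_ge0.
Qed.

Lemma dagger_mul p q r (A : 'M[C]_(p, q)) (B : 'M[C]_(q, r)) :
  dagger (A *m B) = dagger B *m dagger A.
Proof. by rewrite /dagger map_mxM trmx_mul. Qed.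

Lemma daggerK p q (A : 'M[C]_(p, q)) : dagger (dagger A) = A.
Proof. by apply/matrixP => i j; rewrite !mxE conjcK. Qed.

Lemma daggerD p q (A B : 'M[C]_(p, q)) : dagger (A + B) = dagger A + dagger B.
Proof. by apply/matrixP => i j; rewrite !mxE rmorphD. Qed.

Lemma daggerN p q (A : 'M[C]_(p, q)) : dagger (- A) = - dagger A.
Proof. by apply/matrixP => i j; rewrite !mxE rmorphN. Qed.

Lemma daggerB p q (A B : 'M[C]_(p, q)) : dagger (A - B) = dagger A - dagger B.
Proof. by rewrite daggerD daggerN. Qed.

Lemma daggerZ p q (a : C) (A : 'M[C]_(p, q)) : dagger (a *: A) = (a^*)%C *: dagger A.
Proof. by apply/matrixP => i j; rewrite !mxE rmorphM. Qed.

Lemma dagger1 : dagger (1%:M : E) = 1%:M.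
Proof. by rewrite /dagger map_mx1 trmx1. Qed.

Lemma trace_dagger (A : E) : \tr (dagger A) = ((\tr A)^*)%C.
Proof. by rewrite /dagger mxtrace_tr /mxtrace rmorph_sum; apply: eq_bigr => i _; rewrite !mxE. Qed.

Lemma nrmE (x : E) : nrm x = Num.sqrt (ip x x). Proof. by rewrite unlock. Qed.

Implicit Types x y : E.

Lemma ipE x y : ip x y = \sum_i \sum_j (Re (x i j) * Re (y i j) + Im (x i j) * Im (y i j)).
Proof.
rewrite /ip /mxtrace Re_sum exchange_big /=; apply: eq_bigr => i _.
rewrite !mxE Re_sum; apply: eq_bigr => j _.
by rewrite !mxE Re_mul Re_conjc Im_conjc mulNr opprK.
Qed.

Lemma ipC x y : ip x y = ip y x.
Proof. by rewrite !ipE; apply: eq_bigr => i _; apply: eq_bigr => j _; rewrite mulrC (mulrC (Im _)). Qed.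

Lemma ipDl x y (z : E) : ip (x + y) z = ip x z + ip y z.
Proof. by rewrite /ip daggerD mulmxDl mxtraceD Re_add. Qed.
Lemma ipDr x y (z : E) : ip z (x + y) = ip z x + ip z y.
Proof. by rewrite /ip mulmxDr mxtraceD Re_add. Qed.
Lemma ipNl x (z : E) : ip (- x) z = - ip x z.
Proof. by rewrite /ip daggerN mulNmx raddfN Re_opp. Qed.
Lemma ipNr x (z : E) : ip z (- x) = - ip z x.
Proof. by rewrite ipC ipNl ipC. Qed.
Lemma ipZr (r : R) x (z : E) : ip z (r%:C *: x) = r * ip z x.
Proof. by rewrite /ip -scalemxAr mxtraceZ Re_mul /= mul0r subr0. Qed.
Lemma ipZl (r : R) x (z : E) : ip (r%:C *: x) z = r * ip x z.
Proof. by rewrite ipC ipZr ipC. Qed.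

Lemma ip_ge0 x : 0 <= ip x x.
Proof. by rewrite ipE; apply: sumr_ge0 => i _; apply: sumr_ge0 => j _; rewrite addr_ge0 // -expr2 sqr_ge0. Qed.

Lemma nrm_ge0 x : 0 <= nrm x. Proof. by rewrite nrmE sqrtr_ge0. Qed.
Hint Resolve nrm_ge0 : core.

Lemma nrm_sq x : nrm x ^+ 2 = ip x x. Proof. by rewrite nrmE sqr_sqrtr ?ip_ge0. Qed.

Lemma modc_entry (x : E) i j : modc (x i j) <= nrm x.
Proof.
rewrite /modc nrmE ler_sqrt ?ip_ge0 // ipE (bigD1 i) //= (bigD1 j) //= -!expr2 -addrA lerDl.
apply: addr_ge0; apply: sumr_ge0 => k _; rewrite ?addr_ge0 // -?expr2 ?sqr_ge0 //.
by apply: sumr_ge0 => l _; rewrite addr_ge0 // -?expr2 ?sqr_ge0.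
Qed.

Lemma Re_le_modc z : `|Re z| <= modc z.
Proof. by rewrite -lecR -normE normc_ge_Re. Qed.

Lemma Im_le_modc z : `|Im z| <= modc z.
Proof.
by rewrite /modc -sqrtr_sqr ler_sqrt ?addr_ge0 ?sqr_ge0 // lerDr sqr_ge0.
Qed.

Lemma modc_eq0 z : modc z = 0 -> z = 0.
Proof. by move=> h; apply/eqP; rewrite -normr_eq0 normE h. Qed.

Lemma nrm_eq0 x : nrm x = 0 -> x = 0.
Proof.
move=> h; apply/matrixP => i j; rewrite mxE; apply: modc_eq0; apply/eqP.
by rewrite eq_le modc_ge0 -{1}h modc_entry.
Qed.

Lemma nrm0 : nrm (0 : E) = 0.
Proof. by rewrite !nrmE /ip mulmx0 mxtrace0 sqrtr0. Qed.

Lemma nrmN x : nrm (- x) = nrm x.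
Proof. by rewrite !nrmE ipNl ipNr opprK. Qed.

(** Cauchy-Schwarz. With a, b the norms of x, y and c their inner product, the squared norm of b x -
    a y is 2 a b (a b - c), and a b is positive once the zero cases are set aside. *)
Lemma ip_le x y : ip x y <= nrm x * nrm y.
Proof.
have [hx|hx] := eqVneq (nrm x) 0.
  by rewrite (nrm_eq0 hx) nrm0 mul0r /ip /dagger map_mx0 trmx0 mul0mx mxtrace0.
have [hy|hy] := eqVneq (nrm y) 0.
  by rewrite (nrm_eq0 hy) nrm0 mulr0 /ip mulmx0 mxtrace0.
have px : 0 < nrm x by rewrite lt_def hx nrm_ge0.
have py : 0 < nrm y by rewrite lt_def hy nrm_ge0.
have := ip_ge0 ((nrm y)%:C *: x - (nrm x)%:C *: y).
rewrite ipDl !ipDr !ipNl !ipNr !ipZl !ipZr -!nrm_sq (ipC y x).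
set a := nrm x; set b := nrm y; set c := ip x y => h.
have : 0 <= (a * b) * (a * b - c) by nra.
by rewrite pmulr_rge0 ?mulr_gt0 // subr_ge0.
Qed.

Lemma nrmD x y : nrm (x + y) <= nrm x + nrm y.
Proof.
rewrite -(@ler_pXn2r _ 2) ?nnegrE ?addr_ge0 //.
rewrite nrm_sq ipDl !ipDr -!nrm_sq (ipC y x).
have := ip_le x y; nra.
Qed.

Lemma nrmB x y : nrm (x - y) <= nrm x + nrm y.
Proof. by rewrite -(nrmN y); apply: nrmD. Qed.

Lemma nrmBC x y : nrm (x - y) = nrm (y - x).
Proof. by rewrite -nrmN opprB. Qed.

Lemma nrm_triangle y x (z : E) : nrm (x - z) <= nrm (x - y) + nrm (y - z).
Proof. by rewrite -{1}(subrKA y); apply: nrmD. Qed.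

Lemma nrmZ (z : C) x : nrm (z *: x) = modc z * nrm x.
Proof.
rewrite !nrmE /modc -sqrtrM ?addr_ge0 ?sqr_ge0 //; congr Num.sqrt.
rewrite /ip daggerZ -scalemxAl -scalemxAr scalerA mxtraceZ Re_mul.
by case: z => a b /=; ring.
Qed.

Lemma modcR (r : R) : modc r%:C = `|r|.
Proof. by rewrite /modc /= expr0n /= addr0 sqrtr_sqr. Qed.

Lemma nrmZR (r : R) x : nrm (r%:C *: x) = `|r| * nrm x.
Proof. by rewrite nrmZ modcR. Qed.

Lemma nrm_sum I (r : seq I) (P : pred I) (F : I -> E) :
  nrm (\sum_(i <- r | P i) F i) <= \sum_(i <- r | P i) nrm (F i).
Proof.
elim/big_rec2: _ => [|i y x _ h]; first by rewrite nrm0.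
by rewrite (le_trans (nrmD _ _)) // lerD2l.
Qed.

Lemma nrm_delta i j : nrm (delta_mx i j : E) = 1.
Proof.
rewrite !nrmE ipE (bigD1 i) //= (bigD1 j) //= !big1 ?addr0.
- by rewrite !mxE !eqxx /= mul0r addr0 mulr1 sqrtr1.
- by move=> k hk; apply: big1 => l _; rewrite !mxE (negPf hk) /= !mul0r addr0.
- by move=> k hk; rewrite !mxE (negPf hk) eqxx andbF /= !mul0r addr0.
Qed.

Lemma nrm_entries (e : R) (x : E) : (forall i j, modc (x i j) <= e) ->
  nrm x <= (N * N)%:R * e.
Proof.
move=> h; rewrite (matrix_sum_delta x).
apply: le_trans (nrm_sum _ _ _) _.
apply: (@le_trans _ _ (\sum_(i < N) N%:R * e)).
  apply: ler_sum => i _; apply: le_trans (nrm_sum _ _ _) _.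
  apply: (@le_trans _ _ (\sum_(j < N) e)).
    by apply: ler_sum => j _; rewrite nrmZ nrm_delta mulr1.
  by rewrite sumr_const card_ord mulr_natl.
by rewrite sumr_const card_ord natrM -mulrA [in leRHS]mulr_natl.
Qed.

Definition clin (L : E -> E) := forall (a : C) x y, L (a *: x + y) = a *: L x + L y.

Section LinearMap.
Variable L : E -> E.
Hypothesis hL : clin L.

Lemma clin0 : L 0 = 0.
Proof.
by have := hL 1 0 0; rewrite !scale1r addr0 => h; apply: (@addIr _ (L 0)); rewrite -h add0r.
Qed.
Lemma clinD x y : L (x + y) = L x + L y.
Proof. by have := hL 1 x y; rewrite !scale1r. Qed.
Lemma clinZ a x : L (a *: x) = a *: L x.
Proof. by have := hL a x 0; rewrite clin0 !addr0. Qed.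
Lemma clinN x : L (- x) = - L x.
Proof. by rewrite -[- x]scaleN1r -[RHS]scaleN1r clinZ. Qed.
Lemma clinB x y : L (x - y) = L x - L y.
Proof. by rewrite clinD clinN. Qed.
Lemma clin_sum I (r : seq I) (P : pred I) (F : I -> E) :
  L (\sum_(i <- r | P i) F i) = \sum_(i <- r | P i) L (F i).
Proof. exact: (big_morph L clinD clin0). Qed.
Lemma clin_delta x : L x = \sum_i \sum_j x i j *: L (delta_mx i j).
Proof.
rewrite {1}(matrix_sum_delta x) clin_sum; apply: eq_bigr => i _.
by rewrite clin_sum; apply: eq_bigr => j _; rewrite clinZ.
Qed.

(** Upgrades an estimate on the finitely many matrix units to an operator bound: each of the N^2
    coefficients of x is at most [nrm x]. *)
Lemma clin_bound_delta b : (forall i j, nrm (L (delta_mx i j)) <= b) ->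
  forall x, nrm (L x) <= (N * N)%:R * b * nrm x.
Proof.
move=> hb x; rewrite clin_delta; apply: le_trans (nrm_sum _ _ _) _.
apply: (@le_trans _ _ (\sum_(i < N) \sum_(j < N) (nrm x * b))).
  apply: ler_sum => i _; apply: le_trans (nrm_sum _ _ _) _.
  apply: ler_sum => j _; rewrite nrmZ ler_pM ?modc_ge0 // ?modc_entry //.
by rewrite !(sumr_const, card_ord) -mulrnA -[in leLHS]mulr_natl mulrAC -mulrA.
Qed.

Lemma clin_bound : exists2 b : R, 0 <= b & forall x, nrm (L x) <= b * nrm x.
Proof.
pose b := \sum_i \sum_j nrm (L (delta_mx i j)).
have b0 : 0 <= b by apply: sumr_ge0 => i _; apply: sumr_ge0.
exists ((N * N)%:R * b); first by rewrite mulr_ge0.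
apply: clin_bound_delta => i j; rewrite /b (bigD1 i) //= (bigD1 j) //= -addrA lerDl.
by rewrite addr_ge0 // sumr_ge0 // => k _; apply: sumr_ge0.
Qed.
End LinearMap.

Lemma clin_add L M : clin L -> clin M -> clin (fun x => L x + M x).
Proof. by move=> hL hM a x y; rewrite hL hM scalerDr addrACA. Qed.
Lemma clin_scale (a : C) L : clin L -> clin (fun x => a *: L x).
Proof. by move=> hL b x y; rewrite hL scalerDr !scalerA mulrC. Qed.
Lemma clin_opp L : clin L -> clin (fun x => - L x).
Proof. by move=> hL b x y; rewrite hL opprD scalerN. Qed.
Lemma clin_comp L M : clin L -> clin M -> clin (fun x => L (M x)).
Proof. by move=> hL hM a x y; rewrite hM hL. Qed.
Lemma clin_id : clin id. Proof. by []. Qed.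
Lemma clin_mul (A B : E) : clin (fun x => A *m x *m B).
Proof. by move=> a x y; rewrite mulmxDr mulmxDl -scalemxAr -scalemxAl. Qed.
Lemma clin_mull (A : E) : clin (fun x => A *m x).
Proof. by move=> a x y; rewrite mulmxDr -scalemxAr. Qed.
Lemma clin_mulr (A : E) : clin (fun x => x *m A).
Proof. by move=> a x y; rewrite mulmxDl -scalemxAl. Qed.
Lemma clin_iter k L : clin L -> clin (iter k L).
Proof. by move=> hL; elim: k => //= k ih; apply: clin_comp. Qed.

Lemma iter_bound L b : clin L -> 0 <= b -> (forall x, nrm (L x) <= b * nrm x) ->
  forall k x, nrm (iter k L x) <= b ^+ k * nrm x.
Proof.
move=> hL b0 hb; elim=> [|k ih] x; first by rewrite mul1r.
by rewrite /= (le_trans (hb _)) // exprS -mulrA ler_wpM2l.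
Qed.

End HilbertSchmidt.

(** * Exponential generating series of real sequences *)

Section ExpSeries.
Variable R : realType.

(** The growth of the entries of [iter k L x]; it makes the sum of a_k t^k / k! converge for every
    t. *)
Definition geom_bounded (a : nat -> R) :=
  exists K b : R, [/\ 0 <= K, 0 <= b & forall k, `|a k| <= K * b ^+ k].

Definition exp_gen (a : nat -> R) (t : R) : R :=
  limn (pseries (fun k => a k / k`!%:R) t).

Lemma geom_bounded_shift a : geom_bounded a -> geom_bounded (fun k => a k.+1).
Proof.
move=> [K [b [K0 b0 h]]]; exists (K * b), b; split=> //; first exact: mulr_ge0.
by move=> k; rewrite -mulrA -exprS.
Qed.

(** Absolute convergence, by comparison with the series of K exp (b |t|). *)
Lemma cvg_exp_gen a t : geom_bounded a -> cvgn (pseries (fun k => a k / k`!%:R) t).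
Proof.
move=> [K [b [K0 b0 h]]].
apply: normed_cvg.
have hc : cvgn (series (K *: exp_coeff (b * `|t|))).
  by apply: is_cvg_seriesZ; exact: is_cvg_series_exp_coeff.
have hE k : (K *: exp_coeff (b * `|t|)) k = K * ((b * `|t|) ^+ k / k`!%:R) by [].
apply: series_le_cvg hc => //= k; rewrite hE.
  by rewrite mulr_ge0 // divr_ge0 ?exprn_ge0 ?mulr_ge0.
rewrite normrM normrX normrM normfV [`|k`!%:R|]ger0_norm ?ler0n //.
rewrite exprMn mulrAC !mulrA ler_pM2r ?invr_gt0 ?ltr0n ?fact_gt0 //.
by rewrite ler_wpM2r ?exprn_ge0.
Qed.

Lemma exp_gen0 a : exp_gen a 0 = a 0%N.
Proof.
apply: cvg_lim => //; rewrite -(cvg_shiftn 1).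
apply: (@cvg_trans _ ((fun=> a 0%N) @ \oo)%classic); last exact: cvg_cst.
apply: near_eq_cvg; near=> n.
rewrite /pseries /series /= addn1 big_nat_recl //= expr0 mulr1 fact0 divr1 big1 ?addr0 //.
by move=> i _; rewrite exprS mul0r mulr0.
Unshelve. all: by end_near. Qed.

Lemma exp_genD a b t : geom_bounded a -> geom_bounded b ->
  exp_gen (fun k => a k + b k) t = exp_gen a t + exp_gen b t.
Proof.
move=> ha hb; rewrite /exp_gen -lim_seriesD; try exact: cvg_exp_gen.
by congr (limn (series _)); apply/funext => k /=; rewrite !mulrDl.
Qed.

Lemma exp_genZ c a t : geom_bounded a -> exp_gen (fun k => c * a k) t = c * exp_gen a t.
Proof.
move=> ha; rewrite /exp_gen -[RHS]lim_seriesZ; try exact: cvg_exp_gen.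
by congr (limn (series _)); apply/funext => k; transitivity (c * (a k / k`!%:R * t ^+ k)) => //; rewrite !mulrA.
Qed.

(** Differentiating t^k / k! lowers k by one, which shifts the coefficients. *)
Lemma is_derive_exp_gen a t : geom_bounded a ->
  is_derive t (1 : R) (exp_gen a) (exp_gen (fun k => a k.+1) t).
Proof.
move=> ha.
have dE (b : nat -> R) : pseries_diffs (fun k => b k / k`!%:R) = (fun k => b k.+1 / k`!%:R).
  apply/funext => k; rewrite /pseries_diffs factS natrM invfM mulrCA.
  by rewrite mulVKf // pnatr_eq0.
(* Termwise differentiation at t rests on convergence at the larger radius |t| + 1. *)
have := @pseries_snd_diffs R (fun k => a k / k`!%:R) (`|t| + 1) t.
rewrite !dE; apply.
- exact: cvg_exp_gen.
- exact: cvg_exp_gen (geom_bounded_shift ha).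
- exact: cvg_exp_gen (geom_bounded_shift (geom_bounded_shift ha)).
- by rewrite [ltRHS]ger0_norm ?addr_ge0 // ltrDl.
Qed.
End ExpSeries.

(** * Derivatives of matrix-valued curves *)

Section MatrixDerivative.
Variables (R : realType) (N : nat).
Local Notation C := R[i].
Local Notation E := 'M[C]_N.
Local Notation Re := (@complex.Re R).
Local Notation Im := (@complex.Im R).

(** Taken in real and imaginary parts, the form in which [solves_on] states the differential
    equation. *)
Definition cder (f : R -> C) (t : R) (z : C) :=
  is_derive t (1 : R) (fun s => Re (f s)) (Re z) /\
  is_derive t (1 : R) (fun s => Im (f s)) (Im z).

Definition mder (F : R -> E) (t : R) (M : E) :=
  forall i j, cder (fun s => F s i j) t (M i j).

Lemma is_derive_ext (f g : R -> R) (t a b : R) :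
  (forall s, f s = g s) -> a = b -> is_derive t (1 : R) f a -> is_derive t (1 : R) g b.
Proof. by move=> /funext -> ->. Qed.

Lemma cder_cst z t : cder (fun=> z) t 0.
Proof. by split; exact: is_derive_cst. Qed.

Lemma cderD f g t a b : cder f t a -> cder g t b -> cder (fun s => f s + g s) t (a + b).
Proof.
move=> [f1 f2] [g1 g2]; split.
  by apply: is_derive_ext (is_deriveD f1 g1) => [s|]; rewrite Re_add.
by apply: is_derive_ext (is_deriveD f2 g2) => [s|]; rewrite Im_add.
Qed.

Lemma cderMr f t a (z : C) : cder f t a -> cder (fun s => f s * z) t (a * z).
Proof.
move=> [f1 f2]; split.
  apply: is_derive_ext (is_deriveB (is_deriveZ (Re z) f1) (is_deriveZ (Im z) f2)) => [s|].
    by rewrite Re_mul mulrC (mulrC (Im (f s))).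
  by rewrite Re_mul mulrC (mulrC (Im a)).
apply: is_derive_ext (is_deriveD (is_deriveZ (Im z) f1) (is_deriveZ (Re z) f2)) => [s|].
  by rewrite Im_mul mulrC (mulrC (Im (f s))).
by rewrite Im_mul mulrC (mulrC (Im a)).
Qed.

Lemma cder_sum n (f : 'I_n -> R -> C) t (a : 'I_n -> C) :
  (forall i, cder (f i) t (a i)) -> cder (fun s => \sum_i f i s) t (\sum_i a i).
Proof.
elim: n f a => [|n ih] f a h.
  rewrite big_ord0 (_ : (fun s => _) = fun=> 0); first exact: cder_cst.
  by apply/funext => s; rewrite big_ord0.
rewrite big_ord_recl (_ : (fun s => _) = fun s => f ord0 s + \sum_i f (lift ord0 i) s).
  by apply: cderD => //; apply: ih.
by apply/funext => s; rewrite big_ord_recl.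
Qed.

(** Every entry of L x is a fixed finite linear combination of the entries of x. *)
Lemma mder_clin (F : R -> E) t M L : clin L -> mder F t M -> mder (fun s => L (F s)) t (L M).
Proof.
move=> hL hF i j.
have E1 x : L x i j = \sum_k \sum_l x k l * L (delta_mx k l) i j.
  rewrite (clin_delta hL x) summxE; apply: eq_bigr => k _.
  by rewrite summxE; apply: eq_bigr => l _; rewrite mxE.
rewrite E1 (_ : (fun s => _) = fun s => \sum_k \sum_l F s k l * L (delta_mx k l) i j); last first.
  by apply/funext => s; rewrite E1.
by apply: cder_sum => k; apply: cder_sum => l; apply: cderMr.
Qed.

Lemma mderD (F G : R -> E) t A B : mder F t A -> mder G t B -> mder (fun s => F s + G s) t (A + B).
Proof.
move=> hF hG i j; rewrite mxE (_ : (fun s => _) = fun s => F s i j + G s i j).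
  exact: cderD.
by apply/funext => s; rewrite mxE.
Qed.

Lemma mder_scal (f : R -> R) t (a : R) (M : E) :
  is_derive t (1 : R) f a -> mder (fun s => (f s)%:C *: M) t (a%:C *: M).
Proof.
move=> hf i j; rewrite mxE (_ : (fun s => _) = fun s => (f s)%:C * M i j).
  by apply: cderMr; split => //=; exact: is_derive_cst.
by apply/funext => s; rewrite mxE.
Qed.

End MatrixDerivative.

(** * Exponentials of linear maps and the linear differential equation *)

Section Flow.
Variables (R : realType) (N : nat).
Local Notation C := R[i].
Local Notation E := 'M[C]_N.
Local Notation Re := (@complex.Re R).
Local Notation Im := (@complex.Im R).

Definition cgeom (z : nat -> C) :=
  geom_bounded (fun k => Re (z k)) /\ geom_bounded (fun k => Im (z k)).

Definition cexp (z : nat -> C) (t : R) : C :=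
  Complex (exp_gen (fun k => Re (z k)) t) (exp_gen (fun k => Im (z k)) t).

Lemma geom_boundedD (a b : nat -> R) :
  geom_bounded a -> geom_bounded b -> geom_bounded (fun k => a k + b k).
Proof.
move=> [K [c [K0 c0 ha]]] [K' [c' [K'0 c'0 hb]]].
exists (K + K'), (Num.max c c'); split; rewrite ?addr_ge0 ?le_max ?c0 // => k.
rewrite (le_trans (ler_normD _ _)) // mulrDl lerD //.
  by rewrite (le_trans (ha k)) // ler_wpM2l // lerXn2r ?nnegrE ?le_max ?lexx ?c0.
by rewrite (le_trans (hb k)) // ler_wpM2l // lerXn2r ?nnegrE ?le_max ?lexx ?c'0 ?orbT.
Qed.

Lemma geom_boundedZ (r : R) (a : nat -> R) : geom_bounded a -> geom_bounded (fun k => r * a k).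
Proof.
move=> [K [c [K0 c0 ha]]]; exists (`|r| * K), c; split=> // [|k]; first exact: mulr_ge0.
by rewrite normrM -mulrA ler_wpM2l.
Qed.

Lemma geom_bounded_ext (a b : nat -> R) : a =1 b -> geom_bounded a -> geom_bounded b.
Proof. by move=> /funext ->. Qed.

Lemma exp_gen_ext (a b : nat -> R) t : a =1 b -> exp_gen a t = exp_gen b t.
Proof. by move=> /funext ->. Qed.

Lemma cgeomD z w : cgeom z -> cgeom w -> cgeom (fun k => z k + w k).
Proof.
move=> [z1 z2] [w1 w2]; split.
  by apply: geom_bounded_ext (geom_boundedD z1 w1) => k; rewrite Re_add.
by apply: geom_bounded_ext (geom_boundedD z2 w2) => k; rewrite Im_add.
Qed.

Lemma cgeomMr z c : cgeom z -> cgeom (fun k => z k * c).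
Proof.
move=> [z1 z2]; split.
  apply: geom_bounded_ext (geom_boundedD (geom_boundedZ (Re c) z1) (geom_boundedZ (- Im c) z2)) => k.
  by rewrite Re_mul; ring.
apply: geom_bounded_ext (geom_boundedD (geom_boundedZ (Im c) z1) (geom_boundedZ (Re c) z2)) => k.
by rewrite Im_mul; ring.
Qed.

Lemma cexpD z w t : cgeom z -> cgeom w -> cexp (fun k => z k + w k) t = cexp z t + cexp w t.
Proof.
move=> [z1 z2] [w1 w2]; apply: complex_eqP; rewrite ?Re_add ?Im_add /= -exp_genD //;
by apply: exp_gen_ext => k; rewrite ?Re_add ?Im_add.
Qed.

Lemma cexpMr z c t : cgeom z -> cexp (fun k => z k * c) t = cexp z t * c.
Proof.
move=> [z1 z2]; apply: complex_eqP; rewrite ?Re_mul ?Im_mul /=.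
  rewrite mulrC (mulrC _ (Im c)) -mulNr -!exp_genZ // -exp_genD; try exact: geom_boundedZ.
  by apply: exp_gen_ext => k; rewrite Re_mul; ring.
rewrite mulrC (mulrC _ (Re c)) -!exp_genZ // -exp_genD; try exact: geom_boundedZ.
by apply: exp_gen_ext => k; rewrite Im_mul; ring.
Qed.

Lemma cgeom0 : cgeom (fun=> 0).
Proof. by split; exists 0, 0; split=> // k; rewrite normr0 mul0r. Qed.

Lemma cexp_sum n (z : 'I_n -> nat -> C) t : (forall i, cgeom (z i)) ->
  cgeom (fun k => \sum_i z i k) /\ cexp (fun k => \sum_i z i k) t = \sum_i cexp (z i) t.
Proof.
elim: n z => [|n ih] z h.
  rewrite big_ord0 (_ : (fun k => _) = fun=> 0); last by apply/funext => k; rewrite big_ord0.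
  split; first exact: cgeom0.
  have := cexpD t cgeom0 cgeom0; rewrite (_ : (fun=> 0 + 0) = fun=> 0 : C).
    by rewrite -{1}[cexp _ _]addr0 => /addrI.
  by apply/funext => k; rewrite addr0.
have [h1 h2] := ih (fun i => z (lift ord0 i)) (fun i => h _).
rewrite (_ : (fun k => _) = fun k => z ord0 k + \sum_i z (lift ord0 i) k); last first.
  by apply/funext => k; rewrite big_ord_recl.
by rewrite big_ord_recl cexpD // h2; split=> //; apply: cgeomD.
Qed.

(* exp (t L), as an entrywise power series. *)
Definition flow (L : E -> E) (t : R) (x : E) : E :=
  \matrix_(i, j) cexp (fun k => iter k L x i j) t.

Section Linear.
Variable L : E -> E.
Hypothesis hL : clin L.

Lemma cgeom_iter x i j : cgeom (fun k => iter k L x i j).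
Proof.
have [b b0 hb] := clin_bound hL.
split; exists (nrm x), b; split=> // [|k]; rewrite ?nrm_ge0 // mulrC;
apply: le_trans (iter_bound hL b0 hb k x);
rewrite (le_trans _ (modc_entry _ i j)) ?Re_le_modc ?Im_le_modc //.
Qed.

Lemma fl0 x : flow L 0 x = x.
Proof.
apply/matrixP => i j; rewrite mxE /cexp !exp_gen0 /=; exact: complex_eqP.
Qed.

(** M commutes with the iterates of L, and its entries are finite combinations of those of its
    argument, so M passes through the series. The case M = L yields the differential equation. *)
Lemma flow_comm M t x : clin M -> (forall y, L (M y) = M (L y)) -> flow L t (M x) = M (flow L t x).
Proof.
move=> hM hc; apply/matrixP => i j; rewrite mxE.
have itM k : iter k L (M x) = M (iter k L x) by elim: k => //= k ->.
have E1 y : M y i j = \sum_k \sum_l y k l * M (delta_mx k l) i j.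
  rewrite (clin_delta hM y) summxE; apply: eq_bigr => k _.
  by rewrite summxE; apply: eq_bigr => l _; rewrite mxE.
rewrite E1 (_ : (fun k => _) = fun n =>
   \sum_k \sum_l iter n L x k l * M (delta_mx k l) i j); last first.
  by apply/funext => n; rewrite itM E1.
have h k l : cgeom (fun n => iter n L x k l * M (delta_mx k l) i j).
  exact: cgeomMr (cgeom_iter _ _ _).
rewrite (cexp_sum t (fun k => (cexp_sum t (h k)).1)).2.
apply: eq_bigr => k _; rewrite (cexp_sum t (h k)).2; apply: eq_bigr => l _.
by rewrite cexpMr ?mxE //; apply: cgeom_iter.
Qed.

Lemma flow_clin t : clin (flow L t).
Proof.
move=> a x y; apply/matrixP => i j; rewrite !mxE [a * _]mulrC -cexpMr; last exact: cgeom_iter.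
rewrite -cexpD; [|exact: cgeomMr (cgeom_iter _ _ _)|exact: cgeom_iter].
congr (cexp _ t); apply/funext => k.
by rewrite (clin_iter k hL) !mxE mulrC.
Qed.

(** The coefficient shift replaces x by L x, and [flow_comm] moves L outside. *)
Lemma mder_flow x t : mder (fun s => flow L s x) t (L (flow L t x)).
Proof.
rewrite -flow_comm // => i j; rewrite mxE.
have [g1 g2] := cgeom_iter x i j.
split.
  apply: is_derive_ext (is_derive_exp_gen t g1) => [s|]; first by rewrite mxE.
  by apply: exp_gen_ext => k; rewrite iterSr.
apply: is_derive_ext (is_derive_exp_gen t g2) => [s|]; first by rewrite mxE.
by apply: exp_gen_ext => k; rewrite iterSr.
Qed.

End Linear.

Lemma mder_comp_affine (F : R -> E) (t a b : R) M : mder F (a * t + b) M ->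
  mder (fun s => F (a * s + b)) t (a%:C *: M).
Proof.
have h : is_derive t (1 : R) (fun s : R => a * s + b) a.
  apply: is_derive_ext (is_deriveD (is_deriveZ a (is_derive_id t (1:R))) (is_derive_cst b t (1:R))) => //.
  by rewrite addr0 /GRing.scale /= mulr1.
move=> hF i j; have [h1 h2] := hF i j; rewrite mxE; split.
  rewrite Re_mul /= mul0r subr0.
  apply: is_derive_ext (@is_derive1_comp R _ _ t _ _ h1 h) => //.
  by rewrite mulrC.
rewrite Im_mul /= mul0r addr0.
apply: is_derive_ext (@is_derive1_comp R _ _ t _ _ h2 h) => //.
by rewrite mulrC.
Qed.

Lemma mder_eq (F : R -> E) t A B : mder F t A -> A = B -> mder F t B.
Proof. by move=> h <-. Qed.

Lemma mder_ext (F G : R -> E) t A : (forall s, F s = G s) -> mder F t A -> mder G t A.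
Proof. by move=> /funext ->. Qed.

Lemma mder_solves_on (L : E -> E) F (a b : R) : (forall t, mder F t (L (F t))) -> solves_on L F a b.
Proof.
move=> h i j; split; [|split]; last by move=> t _; case: (h t i j).
  apply: continuous_subspaceT => t.
  have [h1 _] := h t i j.
  by apply: differentiable_continuous; apply/derivable1_diffP; exact: ex_derive.
apply: continuous_subspaceT => t.
have [_ h1] := h t i j.
by apply: differentiable_continuous; apply/derivable1_diffP; exact: ex_derive.
Qed.

Lemma solves_on_sub (L : E -> E) f g (a b : R) : clin L -> solves_on L f a b -> solves_on L g a b ->
  solves_on L (fun s => f s - g s) a b.
Proof.
move=> hL hf hg i j; have [f1 [f2 f3]] := hf i j; have [g1 [g2 g3]] := hg i j.
have eR : (fun s => Re ((f s - g s) i j)) = (fun s => Re (f s i j)) \- (fun s => Re (g s i j)).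
  by apply/funext => s; rewrite !mxE Re_add Re_opp.
have eI : (fun s => Im ((f s - g s) i j)) = (fun s => Im (f s i j)) \- (fun s => Im (g s i j)).
  by apply/funext => s; rewrite !mxE Im_add Im_opp.
rewrite eR eI; split; [|split].
- by move=> x; apply: continuousB; [exact: f1|exact: g1].
- by move=> x; apply: continuousB; [exact: f2|exact: g2].
move=> t ht; have [p1 p2] := f3 t ht; have [q1 q2] := g3 t ht.
rewrite (clinB hL) !mxE Re_add Re_opp Im_add Im_opp.
by split; apply: is_deriveB.
Qed.

(** Keeps the norm from growing along x' = L x, where the squared norm has derivative
    [2 * ip x (L x)]. *)
Definition dissipative (L : E -> E) := forall x, ip x (L x) <= 0.

Lemma solves_on_nrm (L : E -> E) f (a b : R) : dissipative L -> a <= b -> solves_on L f a b ->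
  nrm (f b) <= nrm (f a).
Proof.
move=> hd ab hf.
pose g i j (s : R) : R := Re (f s i j) ^+ 2 + Im (f s i j) ^+ 2.
have gE s : ip (f s) (f s) = \sum_i \sum_j g i j s.
  by rewrite ipE; apply: eq_bigr => i _; apply: eq_bigr => j _; rewrite /g !expr2.
rewrite !nrmE ler_sqrt ?ip_ge0 // !gE.
have dg (t : R) : a < t < b -> is_derive t (1 : R) (\sum_i \sum_j g i j) (2 * ip (f t) (L (f t))).
  move=> ht.
  have h i j : is_derive t (1 : R) (g i j)
     (2 * (Re (f t i j) * Re (L (f t) i j) + Im (f t i j) * Im (L (f t) i j))).
    have [_ [_ /(_ t ht) [h1 h2]]] := hf i j.
    apply: is_derive_ext (is_deriveD (is_deriveX 2 h1) (is_deriveX 2 h2)) => //.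
    rewrite /GRing.scale /= !expr1; ring.
  have := is_derive_sum (fun i => is_derive_sum (fun j => h i j)).
  by move=> h'; apply: is_derive_eq h' _; rewrite ipE mulr_sumr; apply: eq_bigr => i _; rewrite mulr_sumr.
have fctE' s : (\sum_i \sum_j g i j) s = \sum_i \sum_j g i j s.
  by rewrite fct_sumE; apply: eq_bigr => i _; rewrite fct_sumE.
rewrite -!fctE'.
apply: (@ler0_derive1_le_cc R (\sum_i \sum_j g i j) a b) => //.
- by move=> x; rewrite in_itv /= => /dg h; exact: ex_derive.
- move=> x; rewrite in_itv /= => /dg h; rewrite derive1E derive_val.
  by have := hd (f x); lra.
- have cg i j : {within `[a, b], continuous (g i j)}%classic.
    have [c1 [c2 _]] := hf i j => x.
    have -> : g i j = (fun s => Re (f s i j)) \* (fun s => Re (f s i j))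
                      \+ (fun s => Im (f s i j)) \* (fun s => Im (f s i j)) by [].
    by apply: continuousD; apply: continuousM; [exact: c1|exact: c1|exact: c2|exact: c2].
  have cs (T : topologicalType) n (h : 'I_n -> T -> R) : (forall i, continuous (h i)) -> continuous (\sum_i h i).
    elim: n h => [|n ih] h hc x; first by rewrite big_ord0; apply: cst_continuous.
    by rewrite big_ord_recl; apply: continuousD; [exact: hc|exact: ih].
  by apply: (cs) => i; apply: (cs) => j; exact: cg.
- by rewrite in_itv /= lexx ab.
- by rewrite in_itv /= lexx ab.
Qed.
End Flow.

(** * Uniqueness, semigroup law and first-order expansion of flows *)

Section FlowProperties.
Variables (R : realType) (N : nat).
Local Notation C := R[i].
Local Notation E := 'M[C]_N.
Local Notation Re := (@complex.Re R).
Local Notation Im := (@complex.Im R).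

(** The difference of two solutions is a solution starting at 0, and its norm cannot grow. *)
Lemma solves_on_eq (L : E -> E) f g (a b : R) : clin L -> dissipative L -> a <= b ->
  solves_on L f a b -> solves_on L g a b -> f a = g a -> f b = g b.
Proof.
move=> hL hd ab hf hg e.
have := solves_on_nrm hd ab (solves_on_sub hL hf hg).
rewrite e subrr nrm0 => h; apply/eqP; rewrite -subr_eq0; apply/eqP; apply: nrm_eq0.
by apply/eqP; rewrite eq_le h nrm_ge0.
Qed.

Lemma mder_flow_shift (L : E -> E) x (a t : R) : clin L ->
  mder (fun s => flow L (s - a) x) t (L (flow L (t - a) x)).
Proof.
move=> hL; have := mder_comp_affine (a := 1) (b := - a) (mder_flow hL x (1 * t + - a)).
rewrite mul1r scale1r; apply: mder_ext => s; by rewrite mul1r.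
Qed.

Lemma solves_flow (L : E -> E) f (a b : R) : clin L -> dissipative L -> a <= b ->
  solves_on L f a b -> f b = flow L (b - a) (f a).
Proof.
move=> hL hd ab hf.
have h : solves_on L (fun s => flow L (s - a) (f a)) a b.
  by apply: mder_solves_on => t; apply: mder_flow_shift.
by apply: (solves_on_eq hL hd ab hf h); rewrite subrr fl0.
Qed.

(** Serves to identify explicit solution curves with the flow. *)
Lemma mder_unique (L : E -> E) F (t : R) : clin L -> dissipative L -> 0 <= t ->
  (forall s, mder F s (L (F s))) -> F t = flow L t (F 0).
Proof. by move=> hL hd t0 h; rewrite -{2}[t]subr0; apply: solves_flow => //; apply: mder_solves_on. Qed.

Lemma flow_contract (L : E -> E) (t : R) x : clin L -> dissipative L -> 0 <= t ->
  nrm (flow L t x) <= nrm x.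
Proof.
move=> hL hd t0; rewrite -{2}[x](fl0 L); apply: (solves_on_nrm hd t0 (f := fun s => flow L s x)).
by apply: mder_solves_on => s; apply: mder_flow.
Qed.

(** As functions of t, both sides solve the same equation starting from [flow L s x]. *)
Lemma flow_add (L : E -> E) (s t : R) x : clin L -> dissipative L -> 0 <= t ->
  flow L (s + t) x = flow L t (flow L s x).
Proof.
move=> hL hd t0.
have h := mder_unique hL hd t0 (fun r => mder_flow_shift x (- s) r hL).
have e1 : t - - s = s + t by rewrite opprK addrC.
have e2 : 0 - - s = s by rewrite opprK add0r.
by move: h; rewrite e1 e2.
Qed.

(** The reversed curve r -> [flow L (t - r) x] solves the equation of - L and runs from [flow L t x]
    to x; dissipativity of - L makes it the flow. *)
Lemma flow_oppK (L : E -> E) (t : R) x : clin L -> dissipative (fun y => - L y) -> 0 <= t ->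
  flow (fun y => - L y) t (flow L t x) = x.
Proof.
move=> hL hd t0.
have h s : mder (fun r => flow L (t - r) x) s (- L (flow L (t - s) x)).
  have := mder_comp_affine (a := -1) (b := t) (mder_flow hL x (-1 * s + t)).
  move/mder_ext => /(_ (fun r => flow L (t - r) x)).
  rewrite mulN1r addrC rmorphN rmorph1 scaleN1r; apply=> r; by rewrite mulN1r addrC.
have := mder_unique (clin_opp hL) hd t0 h.
by rewrite subrr subr0 fl0.
Qed.

(** Turns a derivative at 0 into a one-sided first-order estimate on an explicit interval. *)
Lemma is_derive_local (f : R -> R) (d e : R) : is_derive (0 : R) (1 : R) f d -> 0 < e ->
  exists2 r : R, 0 < r & forall h, 0 < h < r -> `|f h - f 0 - h * d| <= e * h.
Proof.
move=> hd e0; have h1 : derivable f 0 1 by exact: ex_derive.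
have h2 : 'D_1 f 0 = d by exact: derive_val.
have := h1; rewrite /derivable -/(derive f 0 1) h2.
move/cvgP => _.
have : (h^-1 *: (f (h *: (1 : R) + 0) - f 0) @[h --> 0^'] --> d)%classic.
  by rewrite -h2; exact: h1.
move/cvgrPdist_le => /(_ e e0) /nbhs_ballP [r /= r0 hr]; exists r => // h /andP[h0 hr'].
have hn : h != 0 by rewrite gt_eqF.
have := hr h; rewrite /ball /= sub0r normrN gtr0_norm // => /(_ hr' hn).
rewrite addr0 /GRing.scale /= mulr1 => hh.
rewrite (_ : _ - _ = - ((d - h^-1 * (f h - f 0)) * h)); last by field.
by rewrite normrN normrM (gtr0_norm h0) ler_wpM2r // ltW.
Qed.

Lemma finite_radius (I : finType) (P : I -> R -> Prop) :
  (forall i, exists2 r : R, 0 < r & forall h, 0 < h < r -> P i h) ->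
  exists2 r : R, 0 < r & forall h, 0 < h < r -> forall i, P i h.
Proof.
move=> hP.
suff [r r0 h] : exists2 r : R, 0 < r & forall h, 0 < h < r -> forall i, i \in enum I -> P i h.
  by exists r => // x hx i; apply: h => //; rewrite mem_enum.
elim: (enum I) => [|i s [r r0 ih]]; first by exists 1.
have [r' r'0 h'] := hP i; exists (Num.min r r'); first by rewrite lt_min r0.
move=> x /andP[x0]; rewrite lt_min => /andP[x1 x2] j; rewrite inE => /orP[/eqP ->|hj].
  by apply: h'; rewrite x0.
by apply: ih => //; rewrite x0.
Qed.

Lemma mder_local (F : R -> E) M e : mder F 0 M -> 0 < e ->
  exists2 r : R, 0 < r & forall h, 0 < h < r -> nrm (F h - F 0 - h%:C *: M) <= e * h.
Proof.
move=> hF e0.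
(* Each of the N^2 entries will contribute an error 2 e' h; the added 1 keeps the denominator
   positive when N = 0. *)
pose e' := e / ((N * N)%:R * 2 + 1).
have D0 : 0 < ((N * N)%:R * 2 + 1 : R) by rewrite ltr_wpDl.
have e'0 : 0 < e' by rewrite divr_gt0.
have [|r r0 hr] := @finite_radius ('I_N * 'I_N)%type (fun p h =>
   modc ((F h - F 0 - h%:C *: M) p.1 p.2) <= 2 * e' * h).
  move=> [i j] /=; have [h1 h2] := hF i j.
  have [r1 r10 hr1] := is_derive_local h1 e'0.
  have [r2 r20 hr2] := is_derive_local h2 e'0.
  exists (Num.min r1 r2) => [|h]; first by rewrite lt_min r10.
  rewrite lt_min => /andP[h0 /andP[hh1 hh2]].
  apply: le_trans (modc_le _) _.
  rewrite !mxE !(Re_add, Re_opp, Im_add, Im_opp, Re_mul, Im_mul) /= !mul0r subr0 addr0.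
  have := hr1 h; rewrite h0 hh1 => /(_ isT).
  have := hr2 h; rewrite h0 hh2 => /(_ isT); lra.
exists r => // h hh; have /andP[h0 _] := hh.
apply: le_trans (nrm_entries (fun i j => hr h hh (i, j))) _.
have eE : e = e' * ((N * N)%:R * 2 + 1) by rewrite /e' divfK // gt_eqF.
by rewrite {1}eE; have := mulr_gt0 e'0 h0; lra.
Qed.

(** First-order expansion on each matrix unit, made uniform in x by [clin_bound_delta]. *)
Lemma flow_local (L : E -> E) e : clin L -> 0 < e ->
  exists2 r : R, 0 < r & forall h, 0 < h < r ->
    forall x, nrm (flow L h x - x - h%:C *: L x) <= e * h * nrm x.
Proof.
move=> hL e0.
pose e' := e / ((N * N)%:R + 1).
have D0 : 0 < ((N * N)%:R + 1 : R) by rewrite ltr_wpDl.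
have e'0 : 0 < e' by rewrite divr_gt0.
have [|r r0 hr] := @finite_radius ('I_N * 'I_N)%type (fun p h =>
   nrm (flow L h (delta_mx p.1 p.2) - delta_mx p.1 p.2 - h%:C *: L (delta_mx p.1 p.2)) <= e' * h).
  move=> [i j] /=; have := mder_local (mder_flow hL (delta_mx i j) 0) e'0.
  by rewrite !fl0.
exists r => // h hh x; have /andP[h0 _] := hh.
have hc : clin (fun x => flow L h x - x - h%:C *: L x).
  apply: clin_add; last by apply: clin_opp; apply: clin_scale.
  apply: clin_add; first exact: flow_clin.
  by apply: clin_opp; apply: clin_id.
apply: le_trans (clin_bound_delta hc (fun i j => hr h hh (i, j)) x) _.
rewrite ler_wpM2r ?nrm_ge0 //.
have eE : e = e' * ((N * N)%:R + 1) by rewrite /e' divfK // gt_eqF.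
by rewrite {1}eE; have := mulr_gt0 e'0 h0; lra.
Qed.

End FlowProperties.

(** * Tangent cones of closed semigroups of nonexpansive maps *)

Section TangentCone.
Variables (R : realType) (N : nat).
Local Notation C := R[i].
Local Notation E := 'M[C]_N.

(** Stated for differences, since members of a semigroup are not assumed linear. *)
Definition nonexpansive (S : E -> E) :=
  S 0 = 0 /\ forall x y, nrm (S x - S y) <= nrm (x - y).

(** Closedness is in operator norm: the error is measured relative to [nrm x]. *)
Definition closed_semigroup (SS : (E -> E) -> Prop) :=
  [/\ SS id, (forall S S', SS S -> SS S' -> SS (fun x => S (S' x))),
      (forall S, SS S -> nonexpansive S) &
      (forall F : E -> E, (forall e : R, 0 < e -> exists2 S, SS S & forall x, nrm (F x - S x) <= e * nrm x) ->
         SS F)].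

Lemma nonexpansive_le S x : nonexpansive S -> nrm (S x) <= nrm x.
Proof. by move=> [h0 h]; have := h x 0; rewrite h0 !subr0. Qed.

Section Semigroup.
Variable SS : (E -> E) -> Prop.
Hypothesis hSS : closed_semigroup SS.

Definition tangent (L : E -> E) :=
  forall e : R, 0 < e -> exists2 r : R, 0 < r & forall h, 0 < h < r ->
    exists2 S, SS S & forall x, nrm (S x - x - h%:C *: L x) <= e * h * nrm x.

Lemma tangent_ext L M : (forall x, L x = M x) -> tangent L -> tangent M.
Proof. by move=> /funext ->. Qed.

(** Steps compose: [SA (SB x)] agrees with x + h (A x + B x) up to the two individual errors and the
    cross term h A (SB x - x), which is of order h^2. *)
Lemma tangent_add A B : clin A -> clin B -> tangent A -> tangent B ->
  tangent (fun x => A x + B x).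
Proof.
move=> hA hB tA tB e e0.
have [a a0 ha] := clin_bound hA; have [b b0 hb] := clin_bound hB.
have e4 : 0 < e / 4 by lra.
have [r1 r10 h1] := tA _ e4; have [r2 r20 h2] := tB _ e4.
(* For h < e / D the cross term is at most [e / 4 * h * nrm x]. *)
pose D := 4 * (a * (e + b) + 1).
have D0 : 0 < D by rewrite /D; have := mulr_ge0 a0 (addr_ge0 (ltW e0) b0); lra.
exists (Num.min (Num.min r1 r2) (e / D)) => [|h]; first by rewrite !lt_min r10 r20 divr_gt0.
rewrite !lt_min => /andP[h0 /andP[/andP[hr1 hr2] hr3]].
have [|SA sA eA] := h1 h; first by rewrite h0.
have [|SB sB eB] := h2 h; first by rewrite h0.
have [_ hcomp hne _] := hSS.
exists (fun x => SA (SB x)) => [|x]; first exact: hcomp.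
have -> : SA (SB x) - x - h%:C *: (A x + B x) =
  (SA (SB x) - SB x - h%:C *: A (SB x)) + (SB x - x - h%:C *: B x) + h%:C *: (A (SB x - x)).
  rewrite (clinB hA) scalerDr scalerBr.
  by apply/matrixP => i j; rewrite !mxE; ring.
have n1 := eA (SB x); have n2 := eB x; have n0 := nonexpansive_le x (hne _ sB).
have n3 : nrm (SB x - x) <= (e / 4 * h + h * b) * nrm x.
  have -> : SB x - x = (SB x - x - h%:C *: B x) + h%:C *: B x by rewrite subrK.
  rewrite (le_trans (nrmD _ _)) // mulrDl lerD // nrmZR gtr0_norm // -mulrA ler_wpM2l // ltW //.
have n4 : nrm (h%:C *: A (SB x - x)) <= e / 4 * h * nrm x.
  rewrite nrmZR gtr0_norm // mulrAC mulrC ler_wpM2r ?(ltW h0) //.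
  apply: (le_trans (ha _)); apply: (le_trans (ler_wpM2l a0 n3)).
  rewrite mulrA ler_wpM2r ?nrm_ge0 //.
  have : h * D <= e by rewrite -ler_pdivlMr // ltW.
  rewrite /D; have := mulr_ge0 a0 (mulr_ge0 (ltW h0) (ltW e0)).
  nra.
have n5 : e / 4 * h * nrm (SB x) <= e / 4 * h * nrm x.
  by rewrite ler_wpM2l // mulr_ge0 ?ltW.
have ex : 0 <= e * h * nrm x by rewrite mulr_ge0 ?nrm_ge0 // mulr_ge0 ?ltW.
apply: (le_trans (nrmD _ _)); have := nrmD (SA (SB x) - SB x - h%:C *: A (SB x)) (SB x - x - h%:C *: B x).
lra.
Qed.

(** A step of length h for c A is a step of length h c for A; for c = 0 the identity serves. *)
Lemma tangent_scale (c : R) A : 0 <= c -> tangent A -> tangent (fun x => c%:C *: A x).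
Proof.
move=> c0 tA e e0; have [hid _ _ _] := hSS.
have [-> | cn] := eqVneq c 0.
  exists 1 => // h /andP[h0 _]; exists id => // x.
  by rewrite subrr scale0r scaler0 subr0 nrm0 !mulr_ge0 ?nrm_ge0 ?ltW.
have cp : 0 < c by rewrite lt_def cn.
have [r r0 hr] := tA (e / c) (divr_gt0 e0 cp).
exists (r / c) => [|h /andP[h0 hh]]; first by rewrite divr_gt0.
have [|S sS eS] := hr (h * c); first by rewrite mulr_gt0 //= -ltr_pdivlMr.
exists S => // x; have := eS x.
by rewrite scalerA -rmorphM (_ : e / c * (h * c) = e * h) //; field.
Qed.

Lemma tangent_lim L : (forall e : R, 0 < e -> exists2 A, tangent A & forall x, nrm (L x - A x) <= e * nrm x) ->
  tangent L.
Proof.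
move=> hL e e0; have e2 : 0 < e / 2 by lra.
have [A tA hA] := hL _ e2; have [r r0 hr] := tA _ e2.
exists r => // h hh; have /andP[h0 _] := hh; have [S sS eS] := hr h hh.
exists S => // x.
have -> : S x - x - h%:C *: L x = (S x - x - h%:C *: A x) - h%:C *: (L x - A x).
  by apply/matrixP => i j; rewrite !mxE; ring.
apply: (le_trans (nrmB _ _)); rewrite nrmZR gtr0_norm //.
by have := eS x; have := ler_wpM2l (ltW h0) (hA x); lra.
Qed.

(** Since U V = 1, the error of U S V at x is U applied to the error of S at V x, and U and V are
    nonexpansive. *)
Lemma tangent_conj U V L : SS U -> SS V -> clin U -> (forall x, U (V x) = x) -> tangent L ->
  tangent (fun x => U (L (V x))).
Proof.
move=> sU sV hU UV tL e e0; have [_ hcomp hne _] := hSS.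
have [r r0 hr] := tL _ e0; exists r => // h hh; have [S sS eS] := hr h hh.
exists (fun x => U (S (V x))) => [|x]; first by apply: (hcomp) => //; apply: (hcomp).
rewrite -{2}[x]UV -(clinZ hU) -!(clinB hU).
apply: le_trans (nonexpansive_le _ (hne _ sU)) _; apply: le_trans (eS _) _.
rewrite ler_wpM2l ?nonexpansive_le //; last exact: hne.
by have /andP[h0 _] := hh; rewrite mulr_ge0 ?ltW.
Qed.

Lemma tangent_of_flow L : clin L -> (forall t, 0 <= t -> SS (flow L t)) -> tangent L.
Proof.
move=> hL hS e e0; have [r r0 hr] := flow_local hL e0.
by exists r => // h hh; exists (flow L h); [apply: hS; case/andP: hh => /ltW|exact: hr].
Qed.

(* Euler scheme: since both the flow and the steps are nonexpansive, the local errors add up. *)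
Lemma flow_of_tangent L t : clin L -> dissipative L -> tangent L -> 0 <= t -> SS (flow L t).
Proof.
move=> hL hd tL t0; have [hid hcomp hne hclosed] := hSS.
apply: hclosed => e e0.
have [t00 | tn] := eqVneq t 0.
  by exists id => // x; rewrite t00 fl0 subrr nrm0 mulr_ge0 ?nrm_ge0 ?ltW.
have tp : 0 < t by rewrite lt_def tn.
(* Each of n steps of length h = t / n will cost 2 d h relative to [nrm x]; the total 2 d t is e. *)
pose d := e / (2 * t).
have d0 : 0 < d by rewrite divr_gt0 // mulr_gt0.
have [r1 r10 h1] := tL _ d0; have [r2 r20 h2] := flow_local hL d0.
pose r := Num.min r1 r2; have rp : 0 < r by rewrite lt_min r10.
(* The successor makes n exceed t / r, so that h < r. *)
pose n := (Num.truncn (t / r)).+1; pose h := t / n%:R.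
have n0 : 0 < n%:R :> R by rewrite ltr0n.
have hp : 0 < h by rewrite divr_gt0.
have hr : h < r.
  rewrite /h ltr_pdivrMr // mulrC -ltr_pdivrMr //.
  by apply: truncnS_gt.
move: (hr); rewrite lt_min => /andP[hr1 hr2].
have [|S sS eS] := h1 h; first by rewrite hp.
have eF := h2 h; rewrite hp hr2 in eF.
have step x : nrm (S x - flow L h x) <= 2 * d * h * nrm x.
  have -> : S x - flow L h x = (S x - x - h%:C *: L x) - (flow L h x - x - h%:C *: L x).
    by apply/matrixP => i j; rewrite !mxE; ring.
  apply: (le_trans (nrmB _ _)); have := eS x; have := eF isT x; lra.
have main k : SS (iter k S) /\ forall x, nrm (iter k S x - flow L (k%:R * h) x) <= k%:R * (2 * d * h) * nrm x.
  elim: k => [|k [ih1 ih2]].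
    by split=> [|x]; [exact: hid | rewrite !mul0r fl0 subrr nrm0].
  split=> [|x].
    exact: hcomp.
  have -> : k.+1%:R * h = k%:R * h + h by rewrite -natr1; ring.
  rewrite flow_add ?(ltW hp) //=.
  apply: (le_trans (nrm_triangle (S (flow L (k%:R * h) x)) _ _)).
  have [_ hS2] := hne _ sS.
  have a1 := le_trans (hS2 _ _) (ih2 x).
  have a2 := step (flow L (k%:R * h) x).
  have kh : 0 <= k%:R * h by rewrite mulr_ge0 // ltW.
  have a3 := flow_contract x hL hd kh.
  have p : 0 <= 2 * d * h by rewrite mulr_ge0 ?(ltW hp) // mulr_ge0 ?(ltW d0).
  have a4 := ler_wpM2l p a3.
  rewrite -natr1; lra.
exists (iter n S); first by case: (main n).
move=> x; have [_ /(_ x)] := main n.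
have -> : n%:R * h = t by rewrite /h; field; rewrite gt_eqF.
rewrite nrmBC; move/le_trans; apply; rewrite ler_wpM2r ?nrm_ge0 //.
have -> : n%:R * (2 * d * h) = e.
  by rewrite /d /h; field; rewrite (gt_eqF n0) (gt_eqF tp).
by [].
Qed.

End Semigroup.
End TangentCone.

(** * Commutators of tangent directions and recurrence of isometric flows *)

Section BracketRecurrence.
Variables (R : realType) (N : nat).
Local Notation C := R[i].
Local Notation E := 'M[C]_N.
Local Notation Re := (@complex.Re R).
Local Notation Im := (@complex.Im R).
Variable SS : (E -> E) -> Prop.
Hypothesis hSS : closed_semigroup SS.

(** With y = V x and x = U y, the difference U B V x - B x equals U B y - B U y. Inserting U = 1 + s
    A + rho leaves s [A, B] y plus terms in rho, which are small compared with s; y differs from x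
    by a term of order s. *)
Lemma commutator_estimate (A B U V : E -> E) (a b s e : R) : clin A -> clin B ->
  0 <= a -> (forall x, nrm (A x) <= a * nrm x) ->
  0 <= b -> (forall x, nrm (B x) <= b * nrm x) ->
  0 < s -> 0 <= e -> e <= 1 -> (forall x, U (V x) = x) -> (forall x, nrm (V x) <= nrm x) ->
  (forall x, nrm (U x - x - s%:C *: A x) <= e * s * nrm x) ->
  (forall x, nrm (V x - x - s%:C *: (- A x)) <= e * s * nrm x) ->
  forall x, nrm ((A (B x) - B (A x)) - s^-1%:C *: (U (B (V x)) + - B x)) <=
    (2 * (a * b * (s * (a + 1))) + 2 * (e * b)) * nrm x.
Proof.
move=> hA hB a0 ha b0 hb s0 e0 e1 UV nV eU eV x.
have [rho rhoE] : exists rho : E -> E, forall z, rho z = U z - z - s%:C *: A z by eexists.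
have UE z : U z = z + s%:C *: A z + rho z.
  by rewrite rhoE; apply/matrixP => i j; rewrite !mxE; ring.
have nrho z : nrm (rho z) <= e * s * nrm z by rewrite rhoE.
have := UV x; have := nV x; have := eV x.
move: (V x) => y eVx ny yE.
have id1 : (A (B x) - B (A x)) - s^-1%:C *: (U (B y) + - B x) =
   (A (B (x - y)) - B (A (x - y))) - s^-1%:C *: (rho (B y) - B (rho y)).
  have -> : U (B y) + - B x = s%:C *: (A (B y) - B (A y)) + (rho (B y) - B (rho y)).
    rewrite -{1}yE (UE (B y)) (UE y) !(clinD hB) (clinZ hB).
    by apply/matrixP => i j; rewrite !mxE; ring.
  rewrite scalerDr scalerA -rmorphM mulVf ?gt_eqF // rmorph1 scale1r.
  rewrite !(clinB hB) !(clinB hA) !(clinB hB).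
  by apply/matrixP => i j; rewrite !mxE; ring.
rewrite id1.
have m1 : nrm (x - y) <= s * (a + 1) * nrm x.
  have -> : x - y = s%:C *: A x - (y - x - s%:C *: (- A x)).
    by apply/matrixP => i j; rewrite !mxE; ring.
  apply: (le_trans (nrmB _ _)); rewrite nrmZR gtr0_norm //.
  have q1 := ler_wpM2l (ltW s0) (ha x).
  have q3 : e * s * nrm x <= s * nrm x.
    exact: (ler_wpM2r (nrm_ge0 x) (ler_piMl (ltW s0) e1)).
  rewrite (_ : s * (a + 1) * nrm x = s * (a * nrm x) + s * nrm x); last by ring.
  exact: (lerD q1 (le_trans eVx q3)).
have m2 : nrm (A (B (x - y))) <= a * b * nrm (x - y).
  by rewrite -mulrA (le_trans (ha _)) // ler_wpM2l.
have m3 : nrm (B (A (x - y))) <= a * b * nrm (x - y).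
  by rewrite (mulrC a) -mulrA (le_trans (hb _)) // ler_wpM2l.
have es0 : 0 <= e * s by rewrite mulr_ge0 // ltW.
have m4 : nrm (rho (B y)) <= s * (e * b * nrm x).
  apply: (le_trans (nrho _)).
  apply: (le_trans (ler_wpM2l es0 (le_trans (hb y) (ler_wpM2l b0 ny)))).
  rewrite le_eqVlt; apply/orP; left; apply/eqP; ring.
have m5 : nrm (B (rho y)) <= s * (e * b * nrm x).
  apply: (le_trans (hb _)); apply: (le_trans (ler_wpM2l b0 (le_trans (nrho y) (ler_wpM2l es0 ny)))).
  rewrite le_eqVlt; apply/orP; left; apply/eqP; ring.
have m6 : nrm (s^-1%:C *: (rho (B y) - B (rho y))) <= 2 * (e * b * nrm x).
  have s'0 : 0 < s^-1 by rewrite invr_gt0; exact: s0.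
  rewrite nrmZR (gtr0_norm s'0) mulrC (ler_pdivrMr _ _ s0).
  apply: (le_trans (nrmB _ _)); apply: (le_trans (lerD m4 m5)).
  rewrite le_eqVlt; apply/orP; left; apply/eqP; ring.
have m8 : a * b * nrm (x - y) <= a * b * (s * (a + 1)) * nrm x.
  by rewrite -[leRHS]mulrA ler_wpM2l // mulr_ge0.
apply: (le_trans (nrmB _ _)); rewrite mulrDl -!mulrA; apply: lerD; last by rewrite !mulrA in m6 *.
apply: (le_trans (nrmB _ _)); rewrite mulr_natl mulr2n; apply: lerD.
  by apply: (le_trans m2); rewrite !mulrA in m8 *.
by apply: (le_trans m3); rewrite !mulrA in m8 *.
Qed.

(** U = exp (s A) and its inverse V lie in [SS], so U B V is tangent, and so is its sum with - B.
    Divided by s this tends to the commutator, and the cone is closed. *)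
Lemma tangent_bracket (A B : E -> E) : clin A -> clin B ->
  dissipative A -> dissipative (fun x => - A x) ->
  tangent SS A -> tangent SS (fun x => - A x) -> tangent SS B -> tangent SS (fun x => - B x) ->
  tangent SS (fun x => A (B x) - B (A x)).
Proof.
move=> hA hB dA dA' tA tA' tB tB'; apply: tangent_lim => e e0.
have hN := clin_opp hA.
have [a a0 ha] := clin_bound hA; have [b b0 hb] := clin_bound hB.
(* With s <= e', the bound of [commutator_estimate] is at most e' times this factor. *)
have [e' [e'0 e'1 e'D]] : exists e', [/\ 0 < e', e' <= 1 & e' * (2 * (a * b * (a + 1)) + 2 * b + 1) <= e].
  have D0 : 0 < 2 * (a * b * (a + 1)) + 2 * b + 1.
    by have := mulr_ge0 (mulr_ge0 a0 b0) (addr_ge0 a0 (@ler01 R)); lra.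
  exists (Num.min (e / (2 * (a * b * (a + 1)) + 2 * b + 1)) 1).
  by rewrite lt_min divr_gt0 //= ltr01 -ler_pdivlMr // !ge_min !lexx orbT; split.
have [r1 r10 h1] := flow_local hA e'0; have [r2 r20 h2] := flow_local hN e'0.
have [s [s0 s1 s2 s3]] : exists s, [/\ 0 < s, s < r1, s < r2 & s <= e'].
  have hm : 0 < Num.min (Num.min r1 r2) e' by rewrite !lt_min r10 r20.
  exists (Num.min (Num.min r1 r2) e' / 2).
  have : Num.min (Num.min r1 r2) e' / 2 < Num.min (Num.min r1 r2) e' by lra.
  by rewrite !lt_min => /andP[/andP[-> ->] /ltW ->]; split=> //; rewrite divr_gt0.
have UV x : flow A s (flow (fun x => - A x) s x) = x.
  have := flow_oppK x hN (L := fun x => - A x) (t := s).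
  rewrite (_ : (fun y => - - A y) = A); last by apply/funext => y; rewrite opprK.
  by apply => //; exact: ltW.
have sU : SS (flow A s) by exact: (flow_of_tangent hSS hA dA tA (ltW s0)).
have sV : SS (flow (fun x => - A x) s) by exact: (flow_of_tangent hSS hN dA' tA' (ltW s0)).
have hU : clin (flow A s) by exact: flow_clin.
have hV : clin (flow (fun x => - A x) s) by exact: flow_clin.
have eU x : nrm (flow A s x - x - s%:C *: A x) <= e' * s * nrm x by apply: h1; rewrite s0.
have eV x : nrm (flow (fun x => - A x) s x - x - s%:C *: (- A x)) <= e' * s * nrm x by apply: h2; rewrite s0.
have [_ _ hne _] := hSS.
have nV x := nonexpansive_le x (hne _ sV).
move: (flow A s) (flow (fun x => - A x) s) UV sU sV hU hV eU eV nV => U V UV sU sV hU hV eU eV nV.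
exists (fun x => s^-1%:C *: (U (B (V x)) + - B x)).
  have tU : tangent SS (fun x => U (B (V x))) := tangent_conj hSS sU sV hU UV tB.
  have cU : clin (fun x => U (B (V x))) := clin_comp hU (clin_comp hB hV).
  have s'0 : 0 <= s^-1 by rewrite invr_ge0 ltW.
  exact: (tangent_scale hSS s'0 (tangent_add hSS cU (clin_opp hB) tU tB')).
move=> x; apply: le_trans (commutator_estimate hA hB a0 ha b0 hb s0 (ltW e'0) e'1 UV nV eU eV x) _.
rewrite ler_wpM2r ?nrm_ge0 // (le_trans _ e'D) //.
have p : 0 <= a * b * (a + 1) by rewrite !mulr_ge0 // addr_ge0.
have := ler_wpM2r p s3; move: e'0.
move: (nrm x) => _ {tA tA' tB tB' hA hB dA dA' hN ha hb h1 h2 UV sU sV hU hV eU eV nV hne x U V}.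
lra.
Qed.

(** Cut [-1, 1] into cells of length 1 / M < e; among more indices than cell vectors, two share all
    their cells. *)
Lemma pigeonhole_bounded (J : finType) (F : nat -> J -> R) (e : R) : 0 < e ->
  (forall k j, `|F k j| <= 1) ->
  exists k l : nat, (k < l)%N /\ forall j, `|F l j - F k j| <= e.
Proof.
move=> e0 hF; pose M := (Num.truncn e^-1).+1.
have M0 : 0 < M%:R :> R by rewrite ltr0n.
have hM : M%:R^-1 < e by rewrite invf_plt ?posrE // truncnS_gt.
(* The value 1 falls into cell 2 M, hence 2 M + 1 cells. *)
pose cell k : {ffun J -> 'I_((2 * M).+1)} := [ffun j => inord (Num.truncn ((F k j + 1) * M%:R))].
have F0 k j : 0 <= (F k j + 1) * M%:R.
  by rewrite mulr_ge0 ?ler0n //; have := hF k j; rewrite ler_norml => /andP[]; lra.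
have cellE k j : cell k j = Num.truncn ((F k j + 1) * M%:R) :> nat.
  rewrite ffunE inordK // ltnS -(ler_nat R).
  apply: (@le_trans _ _ ((F k j + 1) * M%:R)); first by rewrite truncn_le F0.
  rewrite natrM ler_wpM2r ?ler0n //; have := hF k j; rewrite ler_norml => /andP[]; lra.
have : ~~ injectiveb (fun k : 'I_(#|{ffun J -> 'I_((2 * M).+1)}|.+1) => cell k).
  by apply/negP => /injectiveP /leq_card; rewrite card_ord ltnn.
move/injectivePn => [k [l kl hc]].
have close (p q : nat) : cell p = cell q -> forall j, `|F p j - F q j| <= e.
  move=> hpq j; have hh : Num.truncn ((F p j + 1) * M%:R) = Num.truncn ((F q j + 1) * M%:R).
    by rewrite -!cellE hpq.
  have := truncn_itv (F0 p j); have := truncn_itv (F0 q j); rewrite hh.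
  set n := Num.truncn _ => /andP[a1 a2] /andP[b1 b2].
  have d1 : `|(F p j - F q j) * M%:R| <= 1.
    by rewrite ler_norml; move: a1 a2 b1 b2; rewrite -natr1; lra.
  move: d1; rewrite normrM (gtr0_norm M0) -ler_pdivlMr // mul1r => d1.
  exact: le_trans d1 (ltW hM).
have [hlt|hlt|heq] := ltngtP k l.
- by exists k, l; split=> // j; apply: close.
- by exists l, k; split=> // j; apply: close.
- by move: kl; rewrite (val_inj heq) eqxx.
Qed.

(** The iterates of matrix units have entries bounded by 1, so two powers k < l of F nearly agree on
    all units; cancelling the isometry F^k leaves F^(l-k) near the identity. *)
Lemma recurrence (F : E -> E) (e : R) : clin F -> (forall x, nrm (F x) = nrm x) -> 0 < e ->
  exists m : nat, forall x, nrm (iter m.+1 F x - x) <= e * nrm x.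
Proof.
move=> hF iso e0.
have itiso k x : nrm (iter k F x) = nrm x by elim: k => //= k <-.
pose e' := e / ((N * N)%:R * (2 * (N * N)%:R) + 1).
have D0 : 0 < ((N * N)%:R * (2 * (N * N)%:R) + 1 : R) by rewrite ltr_wpDl // !mulr_ge0.
have e'0 : 0 < e' by rewrite divr_gt0.
pose G k (p : 'I_N * 'I_N * ('I_N * 'I_N) * bool) :=
  let z := iter k F (delta_mx p.1.1.1 p.1.1.2) p.1.2.1 p.1.2.2 in
  if p.2 then Re z else Im z.
have [||k [l [kl hkl]]] := @pigeonhole_bounded _ G e' => //.
  move=> k [[[i j] [i' j']] b]; rewrite /G /=.
  have h : modc (iter k F (delta_mx i j) i' j') <= 1.
    by rewrite -(nrm_delta R i j) -(itiso k) modc_entry.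
  by case: b; apply: le_trans h; rewrite ?Re_le_modc ?Im_le_modc.
exists (l - k).-1; rewrite prednK ?subn_gt0 // => x.
have -> : nrm (iter (l - k) F x - x) = nrm (iter l F x - iter k F x).
  rewrite -(itiso k) (clinB (clin_iter k hF)) -iterD subnKC //; exact: ltnW.
have hc : clin (fun x => iter l F x - iter k F x).
  by apply: clin_add; [exact: clin_iter|apply: clin_opp; exact: clin_iter].
have hb i j : nrm (iter l F (delta_mx i j) - iter k F (delta_mx i j)) <= (N * N)%:R * (2 * e').
  apply: nrm_entries => i' j'; apply: le_trans (modc_le _) _.
  have := hkl ((i, j), (i', j'), true); have := hkl ((i, j), (i', j'), false).
  rewrite /G /= !mxE Re_add Im_add Re_opp Im_opp; lra.
apply: le_trans (clin_bound_delta hc hb x) _; rewrite ler_wpM2r ?nrm_ge0 //.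
have eE : e = e' * ((N * N)%:R * (2 * (N * N)%:R) + 1) by rewrite /e' divfK // gt_eqF.
by rewrite {1}eE; have := e'0; lra.
Qed.

(* A power of an isometry is close to the identity, so the preceding power is close to the
   inverse. *)
Lemma flow_opp (L : E -> E) : clin L -> dissipative L -> dissipative (fun x => - L x) ->
  (forall t, 0 <= t -> SS (flow L t)) -> forall t, 0 <= t -> SS (flow (fun x => - L x) t).
Proof.
move=> hL hd hd' hS t t0; have [hid hcomp hne hclosed] := hSS.
have hN := clin_opp hL.
have VU x := flow_oppK x hL hd' t0.
have UV x : flow L t (flow (fun x => - L x) t x) = x.
  have := @flow_oppK R N (fun x => - L x) t x hN.
  rewrite (_ : (fun y => - - L y) = L); last by apply/funext => y; rewrite opprK.
  by apply.
have iso x : nrm (flow L t x) = nrm x.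
  apply/eqP; rewrite eq_le flow_contract //= -{1}[x]VU; exact: flow_contract.
apply: hclosed => e e0.
have [m hm] := recurrence (flow_clin hL t) iso e0.
exists (iter m (flow L t)).
  elim: m {hm} => [|m ih]; first exact: hid.
  by apply: (hcomp) => //; exact: hS.
(* At the inverse image of x, the return estimate for the power m + 1 compares the power m at x with
   that inverse image. *)
move=> x; rewrite nrmBC; have := hm (flow (fun x => - L x) t x).
rewrite iterSr UV; move/le_trans; apply.
by rewrite ler_wpM2l ?(ltW e0) // flow_contract.
Qed.

End BracketRecurrence.

(** * Spectral theorem, and unitary conjugations as exponentials of ad *)

Section Spectral.
Variables (R : realType) (N : nat).
Local Notation C := R[i].
Local Notation E := 'M[C]_N.
Local Notation Re := (@complex.Re R).
Local Notation Im := (@complex.Im R).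

Definition unitary (U : E) := dagger U *m U = 1%:M.

Lemma unitaryV U : unitary U -> U *m dagger U = 1%:M.
Proof. exact: mulmx1C. Qed.

Lemma unitary_dagger U : unitary U -> unitary (dagger U).
Proof. by rewrite /unitary daggerK; exact: unitaryV. Qed.

Lemma unitary_mul U V : unitary U -> unitary V -> unitary (U *m V).
Proof. by move=> hU hV; rewrite /unitary dagger_mul mulmxA -(mulmxA _ (dagger U)) hU mulmx1. Qed.

Lemma daggerE p q (A : 'M[C]_(p, q)) : dagger A = map_mx (@Num.conj C) A^T.
Proof. by apply/matrixP => i j; rewrite !mxE. Qed.

Lemma spectral_normal (A : E) : A *m dagger A = dagger A *m A ->
  exists U (d : 'rV[C]_N), unitary U /\ A = U *m diag_mx d *m dagger U.
Proof.
rewrite daggerE => /normalmxP /orthomx_spectralP hA.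
have /unitarymxP hP := spectral_unitarymx A.
have hu := invmx_unitary (spectral_unitarymx A).
exists (dagger (spectralmx A)), (spectral_diag A); split.
  by rewrite /unitary daggerK daggerE.
by rewrite daggerK {1}hA hu daggerE.
Qed.

Definition dg (d : 'I_N -> R) : E := diag_mx (\row_i (d i)%:C).

Lemma dgE d i j : dg d i j = (d i)%:C *+ (i == j).
Proof. by rewrite !mxE. Qed.

Lemma dagger_diag (d : 'rV[C]_N) : dagger (diag_mx d) = diag_mx (map_mx (@conjc R) d).
Proof.
apply/matrixP => i j; rewrite !mxE rmorphMn eq_sym.
by case: eqP => [->|].
Qed.

Lemma diag_mx_conj (A : E) U d : unitary U -> A = U *m diag_mx d *m dagger U ->
  diag_mx d = dagger U *m A *m U.
Proof. by move=> hU ->; rewrite !mulmxA hU mul1mx -mulmxA hU mulmx1. Qed.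

Lemma spectral_hermitian (A : E) : is_hermitian A ->
  exists U (d : 'I_N -> R), unitary U /\ A = U *m dg d *m dagger U.
Proof.
move=> hA; have [|U [d [hU hd]]] := @spectral_normal A; first by rewrite hA.
exists U, (fun i => Re (d 0 i)); split=> //.
suff -> : dg (fun i => Re (d 0 i)) = diag_mx d by [].
have e := diag_mx_conj hU hd.
have : dagger (diag_mx d) = diag_mx d.
  by rewrite e !dagger_mul daggerK hA !mulmxA.
rewrite dagger_diag => /matrixP h; apply/matrixP => i j; rewrite !mxE.
have := h i i; rewrite !mxE eqxx !mulr1n => hc; congr (_ *+ _).
have := congr1 Im hc; rewrite Im_conjc => h0.
apply: complex_eqP => //=; lra.
Qed.

Lemma spectral_skew (A : E) : dagger A = - A ->
  exists U (d : 'I_N -> R), unitary U /\ A = U *m (iu R *: dg d) *m dagger U.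
Proof.
move=> hA; have h : is_hermitian (- (iu R) *: A).
  rewrite /is_hermitian daggerZ hA scalerN -scaleNr; congr (_ *: A).
  by apply: complex_eqP => /=; rewrite ?oppr0 ?opprK.
have [U [d [hU hd]]] := spectral_hermitian h.
exists U, d; split=> //; rewrite -scalemxAr -scalemxAl -hd scalerA mulrN.
have -> : iu R * iu R = -1 by apply: complex_eqP; rewrite ?Re_mul ?Im_mul /=; ring.
by rewrite opprK scale1r.
Qed.

Definition cis (t : R) : C := Complex (cos t) (sin t).

(** The angle is the arc cosine of the real part, up to the sign of the imaginary part. *)
Lemma cis_surj (z : C) : z * (z^*)%C = 1 -> exists t, z = cis t.
Proof.
case: z => a b h; have hab : a ^+ 2 + b ^+ 2 = 1.
  by have := congr1 Re h; rewrite Re_mul /= mulrN opprK -!expr2.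
have a1 : -1 <= a <= 1.
  have : a ^+ 2 <= 1 by rewrite -hab lerDl sqr_ge0.
  by move=> ?; apply/andP; split; nra.
have [_ ca] := acos_def a1; have sa := sin_acos a1.
have sb : sin (acos a) = `|b| by rewrite sa -hab addrAC subrr add0r sqrtr_sqr.
have [b0|b0] := leP 0 b.
  by exists (acos a); rewrite /cis ca sb ger0_norm.
by exists (- acos a); rewrite /cis cosN sinN ca sb ltr0_norm // opprK.
Qed.

Lemma cis_conj_mul a b : cis a * ((cis b)^*)%C = cis (a - b).
Proof. by apply: complex_eqP; rewrite ?Re_mul ?Im_mul /= ?cosB ?sinB; ring. Qed.

Lemma cisD a b : cis (a + b) = cis a * cis b.
Proof. by apply: complex_eqP; rewrite ?Re_mul ?Im_mul /= ?cosD ?sinD; ring. Qed.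

Lemma cis0 : cis 0 = 1.
Proof. by rewrite /cis cos0 sin0. Qed.

Lemma cis_norm a : cis a * ((cis a)^*)%C = 1.
Proof. by rewrite cis_conj_mul subrr cis0. Qed.

Definition dcis (d : 'I_N -> R) : E := diag_mx (\row_i cis (d i)).

Lemma unitary_dcis d : unitary (dcis d).
Proof.
rewrite /unitary dagger_diag mulmx_diag; apply/matrixP => i j; rewrite !mxE.
by rewrite mulrC cis_norm.
Qed.

(** The eigenvalues have modulus 1; their angles provide a logarithm of W. *)
Lemma spectral_unitary (W : E) : unitary W ->
  exists U d, unitary U /\ W = U *m dcis d *m dagger U.
Proof.
move=> hW; have [|U [d [hU hd]]] := @spectral_normal W; first by rewrite unitaryV.
have e := diag_mx_conj hU hd.
have hD : unitary (diag_mx d).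
  by rewrite e; apply: unitary_mul => //; apply: unitary_mul => //; exact: unitary_dagger.
have h1 i : exists t, d 0 i = cis t.
  apply: cis_surj; have := unitaryV hD; rewrite dagger_diag mulmx_diag => /matrixP /(_ i i).
  by rewrite !mxE eqxx.
have [t ht] := choice h1; exists U, t; split=> //.
rewrite {1}hd; congr (_ *m diag_mx _ *m _).
by apply/rowP => i; rewrite mxE ht.
Qed.

Definition ad (A x : E) : E := A *m x - x *m A.

Lemma clin_ad A : clin (ad A).
Proof. by apply: clin_add; [exact: clin_mull|apply: clin_opp; exact: clin_mulr]. Qed.

(** Both traces that arise are traces of skew-Hermitian matrices, [dagger x *m A *m x] and
    [x *m A *m dagger x], hence purely imaginary. *)
Lemma ip_ad (A x : E) : dagger A = - A -> ip x (ad A x) = 0.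
Proof.
move=> hA; rewrite /ip /ad mulmxBr raddfB Re_add Re_opp /=.
have Reskew (B : E) : dagger B = - B -> Re (\tr B) = 0.
  move=> h; have := congr1 (fun B => Re (\tr B)) h.
  by rewrite trace_dagger raddfN Re_conjc Re_opp; lra.
rewrite Reskew; last by rewrite !dagger_mul daggerK hA mulmxN mulNmx mulmxA.
rewrite mxtrace_mulC Reskew ?subrr //.
by rewrite !dagger_mul daggerK hA mulNmx mulmxN mulmxA.
Qed.

Lemma dissipative_ad A : dagger A = - A -> dissipative (ad A).
Proof. by move=> h x; rewrite ip_ad. Qed.

Lemma ad_opp A x : ad (- A) x = - ad A x.
Proof. by rewrite /ad mulNmx mulmxN opprD. Qed.

Lemma dagger_iudg (d : 'I_N -> R) : dagger (iu R *: dg d) = - (iu R *: dg d).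
Proof.
have hi : ((iu R)^*)%C = - iu R by apply: complex_eqP => /=; rewrite ?oppr0.
rewrite daggerZ dagger_diag hi scaleNr; congr (- (_ *: _)).
by apply/matrixP => i j; rewrite !mxE conjc_real.
Qed.

Lemma dagger_sandwich (U B : E) : dagger B = - B ->
  dagger (U *m B *m dagger U) = - (U *m B *m dagger U).
Proof. by move=> h; rewrite !dagger_mul daggerK h mulNmx mulmxN mulmxA. Qed.

Lemma ad_sandwich (U B y : E) : unitary U ->
  ad (U *m B *m dagger U) (U *m y *m dagger U) = U *m ad B y *m dagger U.
Proof.
move=> hU; rewrite /ad mulmxBr mulmxBl !mulmxA.
by rewrite -(mulmxA _ (dagger U) U) hU mulmx1 -(mulmxA _ (dagger U) U) hU mulmx1.
Qed.

(** In the eigenbasis of the generator, entry (k, l) turns at angular speed [d k - d l]; uniqueness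
    identifies this explicit curve with the flow. *)
Lemma flow_ad (U : E) d t x : unitary U -> 0 <= t ->
  let W := U *m dcis (fun i => d i * t) *m dagger U in
  flow (ad (U *m (iu R *: dg d) *m dagger U)) t x = W *m x *m dagger W.
Proof.
move=> hU t0 W; set A := U *m _ *m _.
have hA : dagger A = - A by apply: dagger_sandwich; exact: dagger_iudg.
pose y := dagger U *m x *m U.
pose G s : E := \matrix_(k, l) (cis ((d k - d l) * s) * y k l).
have GE s : G s = dcis (fun i => d i * s) *m y *m dagger (dcis (fun i => d i * s)).
  rewrite dagger_diag mul_diag_mx; apply/matrixP => k l.
  by rewrite mul_mx_diag !mxE mulrAC cis_conj_mul mulrBl.
have dG s : mder G s (ad (iu R *: dg d) (G s)).
  move=> k l; have -> : ad (iu R *: dg d) (G s) k l =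
     (iu R * (d k - d l)%:C * cis ((d k - d l) * s)) * y k l.
    rewrite /ad -scalemxAl -scalemxAr -scalerBr mul_diag_mx mul_mx_diag !mxE.
    by rewrite rmorphB; ring.
  rewrite (_ : (fun s => _) = fun s => cis ((d k - d l) * s) * y k l); last first.
    by apply/funext => s'; rewrite mxE.
  apply: cderMr; set w := d k - d l.
  have hw : is_derive s (1 : R) (fun s : R => w * s) w.
    apply: is_derive_ext (is_deriveZ w (is_derive_id s (1:R))) => //.
    by rewrite /GRing.scale /= mulr1.
  split.
    apply: is_derive_ext (@is_derive1_comp R _ _ s _ _ (is_derive_cos (w * s)) hw) => //.
    by rewrite !(Re_mul, Im_mul) /=; ring.
  apply: is_derive_ext (@is_derive1_comp R _ _ s _ _ (is_derive_sin (w * s)) hw) => //.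
  by rewrite !(Re_mul, Im_mul) /=; ring.
pose F s := U *m G s *m dagger U.
have dF s : mder F s (ad A (F s)).
  apply: mder_eq (mder_clin (clin_mul U (dagger U)) (dG s)) _.
  exact: esym (ad_sandwich _ _ hU).
have F0 : F 0 = x.
  rewrite /F; have -> : G 0 = y by apply/matrixP => k l; rewrite mxE mulr0 cis0 mul1r.
  by rewrite /y !mulmxA (unitaryV hU) mul1mx -mulmxA (unitaryV hU) mulmx1.
rewrite -{1}F0 -(mder_unique (clin_ad A) (dissipative_ad hA) t0 dF).
by rewrite /F GE /W /y !dagger_mul daggerK !mulmxA.
Qed.

Lemma flow_ad_unitary (A : E) t : dagger A = - A -> 0 <= t ->
  exists2 W, unitary W & forall x, flow (ad A) t x = W *m x *m dagger W.
Proof.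
move=> hA t0; have [U [d [hU ->]]] := spectral_skew hA.
exists (U *m dcis (fun i => d i * t) *m dagger U); last by move=> x; apply: flow_ad.
apply: unitary_mul; last exact: unitary_dagger.
by apply: unitary_mul => //; exact: unitary_dcis.
Qed.

(** The angles of W give a skew-Hermitian logarithm. Subtracting their mean makes it traceless and
    changes W only by a global phase, which cancels under conjugation. *)
Lemma unitary_flow_ad (W : E) : (0 < N)%N -> unitary W ->
  exists2 A, in_su A & forall x, flow (ad A) 1 x = W *m x *m dagger W.
Proof.
move=> N0 hW; have [U [d [hU hd]]] := spectral_unitary hW.
have Nn : N%:R != 0 :> R by rewrite pnatr_eq0 -lt0n.
pose p := (\sum_i d i) / N%:R.
pose d' i := d i - p.
exists (U *m (iu R *: dg d') *m dagger U).
  split.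
    by apply: dagger_sandwich; exact: dagger_iudg.
  rewrite mxtrace_mulC mulmxA hU mul1mx mxtraceZ mxtrace_diag.
  under eq_bigr do rewrite mxE.
  rewrite -rmorph_sum sumrB sumr_const card_ord -[p *+ N]mulr_natr divfK // subrr.
  by rewrite rmorph0 mulr0.
move=> x; rewrite flow_ad // hd.
have -> : dcis (fun i => d' i * 1) = cis (- p) *: dcis d.
  apply/matrixP => i j; by rewrite !mxE mulrnAr mulr1 /d' addrC cisD.
rewrite -scalemxAr -scalemxAl daggerZ -!scalemxAl -scalemxAr scalerA cis_norm.
by rewrite scale1r.
Qed.

End Spectral.

(** * Lists of eigenvalues and diagonalization *)

Section Eigenvalues.
Variables (R : realType) (N : nat).
Local Notation C := R[i].
Local Notation E := 'M[C]_N.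

Lemma char_poly_sandwich (U A : E) : unitary U -> char_poly (U *m A *m dagger U) = char_poly A.
Proof.
move=> hU; rewrite /char_poly.
have -> : char_poly_mx (U *m A *m dagger U) =
   map_mx polyC U *m char_poly_mx A *m map_mx polyC (dagger U).
  rewrite /char_poly_mx mulmxBr mulmxBl -!map_mxM; congr (_ - _).
  by rewrite mul_mx_scalar -scalemxAl -map_mxM (unitaryV hU) map_mx1 scalemx1.
rewrite !det_mulmx mulrAC -det_mulmx -map_mxM (unitaryV hU) map_mx1 det1.
by rewrite mul1r.
Qed.

Lemma char_poly_dg (d : 'I_N -> R) : char_poly (dg d) = \prod_i ('X - ((d i)%:C)%:P).
Proof.
rewrite char_poly_trig; last first.
  by apply/is_trig_mxP => i j ij; rewrite dgE -val_eqE (ltn_eqF ij).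
by apply: eq_bigr => i _; rewrite dgE eqxx.
Qed.

Lemma unitary_perm (p : 'S_N) : unitary (perm_mx p : E).
Proof.
by rewrite /unitary /dagger map_perm_mx tr_perm_mx -perm_mxM mulVg perm_mx1.
Qed.

Lemma dg_perm (p : 'S_N) (d : 'I_N -> R) :
  dg (fun i => d (p i)) = perm_mx p *m dg d *m dagger (perm_mx p).
Proof.
rewrite /dagger map_perm_mx tr_perm_mx -row_permE -col_permE.
by apply/matrixP => i j; rewrite !mxE (inj_eq perm_inj).
Qed.

Lemma eigvals_of_dg (A U : E) d : unitary U -> A = U *m dg d *m dagger U ->
  eigvals_of A [seq d i | i <- enum 'I_N].
Proof.
by move=> hU ->; rewrite /eigvals_of char_poly_sandwich // char_poly_dg big_map big_enum.
Qed.

Lemma eigvals_of_perm (A : E) s t : perm_eq s t -> eigvals_of A s -> eigvals_of A t.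
Proof. by move=> st; rewrite /eigvals_of => ->; apply: perm_big. Qed.

Lemma eigvals_of_size (A : E) s : eigvals_of A s -> size s = N.
Proof.
move=> /(congr1 (fun p : {poly C} => size p)); rewrite size_char_poly size_prod_XsubC.
by case.
Qed.

Lemma eigvals_of_perm_eq (A : E) s t : eigvals_of A s -> eigvals_of A t -> perm_eq s t.
Proof.
rewrite /eigvals_of => -> h; apply: (perm_map_inj (@complexI R)).
by apply: prod_XsubC_eq; rewrite !big_map.
Qed.

(** Any ordering of the eigenvalues can be prescribed: the permutation relating it to the diagonal
    of the spectral theorem is absorbed into the unitary. *)
Lemma eigvals_diagonalize (A : E) s : is_hermitian A -> eigvals_of A s ->
  exists2 U, unitary U & A = U *m dg (fun i => s`_i) *m dagger U.
Proof.
move=> hA hs; have [U [d [hU hd]]] := spectral_hermitian hA.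
have hsz := eigvals_of_size hs.
have := eigvals_of_perm_eq (eigvals_of_dg hU hd) hs.
have sz : size s == N by rewrite hsz.
move/(tuple_permP (t := Tuple sz)) => [p hp].
have dE i : d i = s`_(p i).
  have := congr1 (fun u => nth 0 u i) hp.
  rewrite (nth_map i) ?size_enum_ord // nth_ord_enum => ->.
  rewrite (nth_map i) ?size_enum_ord // nth_ord_enum.
  by rewrite (tnth_nth 0).
exists (U *m perm_mx p); first by apply: unitary_mul => //; exact: unitary_perm.
have -> : A = U *m dg (fun i => s`_(p i)) *m dagger U.
  by rewrite hd; congr (_ *m dg _ *m _); apply/funext => i.
by rewrite (dg_perm p (fun i : 'I_N => s`_i)) dagger_mul !mulmxA.
Qed.

Lemma sorted_eigvals (A : E) : is_hermitian A ->
  exists2 s, eigvals_of A s & sorted (fun x y : R => y <= x) s.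
Proof.
move=> hA; have [U [d [hU hd]]] := spectral_hermitian hA.
exists (sort (fun x y : R => y <= x) [seq d i | i <- enum 'I_N]).
  apply: eigvals_of_perm (eigvals_of_dg hU hd); by rewrite perm_sym perm_sort.
by apply: sort_sorted => x y; rewrite orbC le_total.
Qed.

End Eigenvalues.

(** * Majorization of real vectors by T-transforms *)

Section Majorization.
Variable R : realType.

(** The combination, with weights 1 - q and q, of the identity and the transposition of coordinates
    i and j. *)
Definition t_transform (i j : nat) (q : R) (d : nat -> R) (l : nat) : R :=
  if l == i then (1 - q) * d i + q * d j
  else if l == j then (1 - q) * d j + q * d i else d l.

(** Induction on the number of positions where d and e differ. A T-transform moves mass from the
    first surplus j to the first later deficit k until one of the two is settled, and the prefix
    sums still dominate those of e. *)
Lemma majorization_t_transform (P : (nat -> R) -> Prop) (N : nat) :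
  (forall d i j q, (i < N)%N -> (j < N)%N -> i != j -> 0 <= q <= 1 -> P d ->
     P (t_transform i j q d)) ->
  forall d e : nat -> R,
  (forall i j, (i <= j)%N -> (j < N)%N -> e j <= e i) ->
  (forall k, (k <= N)%N -> \sum_(l < k) e l <= \sum_(l < k) d l) ->
  \sum_(l < N) e l = \sum_(l < N) d l -> P d ->
  exists2 d', P d' & forall l, (l < N)%N -> d' l = e l.
Proof.
move=> hP d e he.
have [n] := ubnP #|[pred l : 'I_N | d l != e l]|.
elim: n d => // n ih d hn hle heq Pd.
have [h|] := boolP [forall l : 'I_N, d l == e l].
  by exists d => // l hl; have /forallP /(_ (Ordinal hl)) /eqP := h.
rewrite negb_forall => /existsP [j0 hj0].
have exj : exists l, (l < N)%N && (d l != e l) by exists j0; rewrite ltn_ord.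
case: (ex_minnP exj) => j /andP[jN dej] jmin.
have eqj l : (l < j)%N -> d l = e l.
  move=> lj; apply/eqP/negPn/negP => h; have := jmin l; rewrite h (ltn_trans lj jN) => /(_ isT).
  by rewrite leqNgt lj.
(* The prefix sums up to and including j force the first disagreement to be a surplus. *)
have dj : e j < d j.
  rewrite lt_def dej; have := hle j.+1 jN; rewrite !big_ord_recr /=.
  by rewrite (eq_bigr (fun l : 'I_j => d l)) ?lerD2l // => l _; rewrite eqj.
(* Without a later deficit the total of d would exceed that of e. *)
have exk : exists l, [&& (j < l)%N, (l < N)%N & d l < e l].
  apply: contrapT => hk.
  have hge l : (l < N)%N -> e l <= d l.
    move=> lN; have [lj|jl|->] := ltngtP l j; first by rewrite eqj.
      by rewrite leNgt; apply/negP => h; apply: hk; exists l; rewrite jl lN.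
    exact: ltW.
  have : \sum_(l < N) e l < \sum_(l < N) d l.
    rewrite (bigD1 (Ordinal jN)) //= [ltRHS](bigD1 (Ordinal jN)) //=.
    by apply: ltr_leD => //; apply: ler_sum => l _; apply: hge.
  by rewrite heq ltxx.
case: (ex_minnP exk) => k /and3P[jk kN dk] kmin.
have hge l : (l < k)%N -> e l <= d l.
  move=> lk; have [lj|jl|->] := ltngtP l j; first by rewrite eqj.
    rewrite leNgt; apply/negP => h; have := kmin l; rewrite jl h (ltn_trans lk kN) => /(_ isT).
    by rewrite leqNgt lk.
  exact: ltW.
(* The largest transfer overshooting neither target; it makes d' agree with e at j or at k. *)
pose delta := Num.min (d j - e j) (e k - d k).
have del0 : 0 < delta by rewrite lt_min !subr_gt0 dj dk.
have del1 : delta <= d j - e j by rewrite ge_min lexx.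
have ekj : e k <= e j by apply: he => //; exact: ltnW.
have djk : 0 < d j - d k by rewrite subr_gt0 (lt_le_trans dk) // (le_trans ekj) // ltW.
(* The weight for which the T-transform moves exactly [delta] from j to k. *)
pose q := delta / (d j - d k).
have q0 : 0 <= q by rewrite divr_ge0 ?ltW.
have q1 : q <= 1 by rewrite ler_pdivrMr // mul1r; move: del1 dk ekj; lra.
have qE : q * (d j - d k) = delta by rewrite divfK // gt_eqF.
pose d' := t_transform j k q d.
have nkj : (k == j) = false by rewrite gtn_eqF.
have d'j : d' j = d j - delta by rewrite /d' /t_transform eqxx -qE; ring.
have d'k : d' k = d k + delta by rewrite /d' /t_transform eqxx nkj -qE; ring.
have d'l l : l != j -> l != k -> d' l = d l by rewrite /d' /t_transform => /negPf -> /negPf ->.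
have sumE p : \sum_(l < p) d' l = \sum_(l < p) d l - delta *+ (j < p)%N + delta *+ (k < p)%N.
  elim: p => [|p ihp]; first by rewrite !big_ord0 subr0 addr0.
  rewrite !big_ord_recr /= ihp !ltnS.
  have [pj|jp|pj] := ltngtP p j.
  - by rewrite d'l ?(ltn_eqF pj) ?(ltn_eqF (ltn_trans pj jk)) // !(leqNgt k) (ltn_trans pj jk) /=
       ltnNge (ltnW (ltn_trans pj jk)) /=; ring.
  - have [pk|kp|pk] := ltngtP p k.
    + by rewrite d'l ?(gtn_eqF jp) ?(ltn_eqF pk) //; ring.
    + by rewrite d'l ?(gtn_eqF jp) ?(gtn_eqF kp) //; ring.
    + by rewrite pk d'k mulr1n mulr0n; ring.
  - by rewrite pj d'j [(k < j)%N]ltnNge (ltnW jk) [(k <= j)%N]leqNgt jk mulr1n !mulr0n; ring.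
(* Only the prefix sums with j < p <= k lose [delta]; there the surplus at j leaves that much slack,
   as no deficit occurs before k. *)
have gap p : (j < p <= k)%N -> delta <= \sum_(l < p) d l - \sum_(l < p) e l.
  move=> /andP[jp pk]; rewrite -sumrB (bigD1 (Ordinal jp)) //= ler_wpDr //.
  by apply: sumr_ge0 => l _; rewrite subr_ge0 hge // (leq_trans (ltn_ord l)).
apply: (ih d').
- move: hn; rewrite ltnS; apply: leq_trans; apply: proper_card; apply/properP; split.
    apply/fintype.subsetP => l; rewrite !inE; apply: contraNneq => h.
    have [lj|lj] := eqVneq (l : nat) j; first by move: dej; rewrite -lj h eqxx.
    have [lk|lk] := eqVneq (l : nat) k; first by move: dk; rewrite -lk h ltxx.
    by rewrite d'l // h.
  have [hm|hm] := leP (d j - e j) (e k - d k).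
    exists (Ordinal jN); rewrite !inE //= negbK d'j /delta min_l //.
    by apply/eqP; ring.
  exists (Ordinal kN); rewrite !inE /=; first by rewrite lt_eqF.
  by rewrite negbK d'k /delta min_r ?ltW //; apply/eqP; ring.
- move=> p pN; rewrite sumE; have := hle p pN.
  have [jp|pj] := ltnP j p; have [kp|pk] := ltnP k p; rewrite /= ?mulr1n ?mulr0n; try lra.
  by have := gap p; rewrite jp pk => /(_ isT); lra.
- by rewrite sumE jN kN heq; ring.
- by apply: hP => //; rewrite ?q0 ?q1 // eq_sym nkj.
Qed.

(** With b the indicator of the first k indices and c a threshold, the gap is the sum of (s_l - c)
    (b_l - w_l), because the b_l - w_l add up to 0. For c = s_(k-1) every term is nonnegative. *)
Lemma sum_le_top (N k : nat) (s w : nat -> R) : (k <= N)%N ->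
  (forall i j, (i <= j)%N -> (j < N)%N -> s j <= s i) ->
  (forall l, (l < N)%N -> 0 <= w l <= 1) -> \sum_(l < N) w l = k%:R ->
  \sum_(l < N) s l * w l <= \sum_(l < k) s l.
Proof.
(* For k = 0 the predecessor gives c = s 0, an upper bound of all the s l. *)
move=> kN hs hw sw; pose c := s k.-1.
pose b l : R := (l < k)%N%:R.
have topE (f : nat -> R) : \sum_(l < k) f l = \sum_(l < N) f l * b l.
  rewrite (big_ord_widen N f kN) big_mkcond; apply: eq_bigr => l _.
  by rewrite /b; case: (l < k)%N; rewrite ?mulr1 ?mulr0.
rewrite topE -subr_ge0 -sumrB.
have : \sum_(l < N) (b l - w l) = 0.
  rewrite sumrB sw; apply/eqP; rewrite subr_eq0; apply/eqP.
  have := topE (fun=> 1); rewrite sumr_const card_ord => ->.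
  by apply: eq_bigr => l _; rewrite mul1r.
move=> h0.
have -> : \sum_(l < N) (s l * b l - s l * w l) = \sum_(l < N) (s l - c) * (b l - w l).
  apply/eqP; rewrite -subr_eq0 -sumrB.
  rewrite (eq_bigr (fun l : 'I_N => c * (b l - w l))) => [|l _]; last by ring.
  by rewrite -mulr_sumr h0 mulr0.
apply: sumr_ge0 => l _.
have /andP[w0 w1] := hw l (ltn_ord l).
have [lk|kl] := ltnP l k.
  have : c <= s l by apply: hs; [rewrite -ltnS (ltn_predK lk)|rewrite (ltn_predK lk)].
  by rewrite /b lk => hc; rewrite mulr_ge0 // subr_ge0.
have : s l <= c by apply: hs => //; exact: leq_trans (leq_pred k) kl.
by rewrite /b ltnNge kl => hc; rewrite mulr_le0 // subr_le0.
Qed.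

End Majorization.

(** * Mixing with a reflection, and invariant intersections of half-spaces *)

Section Mixing.
Variables (R : realType) (N : nat).
Local Notation C := R[i].
Local Notation E := 'M[C]_N.
Local Notation Re := (@complex.Re R).
Local Notation Im := (@complex.Im R).

Lemma ip_sandwich (U M x : E) : ip M (U *m x *m dagger U) = ip (dagger U *m M *m U) x.
Proof.
by rewrite /ip !dagger_mul daggerK !mulmxA mxtrace_mulC !mulmxA.
Qed.

Lemma nrm_sandwich (U x : E) : unitary U -> nrm (U *m x *m dagger U) = nrm x.
Proof.
move=> hU; rewrite !nrmE ip_sandwich !mulmxA hU mul1mx -mulmxA hU mulmx1 //.
Qed.

Lemma nonexpansive_clin (F : E -> E) : clin F -> (forall x, nrm (F x) <= nrm x) -> nonexpansive F.
Proof. by move=> hF h; split=> [|x y]; [exact: clin0|rewrite -clinB]. Qed.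

Lemma nonexpansive_limit (F : E -> E) :
  (forall e : R, 0 < e -> exists2 S, nonexpansive S & forall x, nrm (F x - S x) <= e * nrm x) ->
  nonexpansive F.
Proof.
move=> h; split.
  have [S [S0 _] hS] := h 1 ltr01.
  have := hS 0; rewrite S0 subr0 nrm0 mulr0 => h0.
  by apply: nrm_eq0; apply/eqP; rewrite eq_le h0 nrm_ge0.
move=> x y; apply/ler_addgt0Pr => e e0.
pose d := e / (nrm x + nrm y + 1).
have D0 : 0 < nrm x + nrm y + 1 by have := nrm_ge0 x; have := nrm_ge0 y; lra.
have d0 : 0 < d by rewrite divr_gt0.
have [S [S0 hS1] hS] := h d d0.
have a1 := nrm_triangle (S x) (F x) (F y).
have a2 := nrm_triangle (S y) (S x) (F y).
have := hS x; have := hS y; rewrite nrmBC => a3 a4; have a5 := hS1 x y.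
have eE : e = d * (nrm x + nrm y + 1) by rewrite /d divfK // gt_eqF.
move: (nrm (F x - F y)) (nrm (S x - F y)) (nrm (S x - S y)) (nrm (S y - F y)) (nrm (F x - S x)) a1 a2 a3 a4 a5 => p1 p2 p3 p4 p5.
rewrite eE; lra.
Qed.

Definition reflection (Q : E) := is_hermitian Q /\ Q *m Q = 1%:M.

Lemma reflection_unitary Q : reflection Q -> unitary Q.
Proof. by move=> [h1 h2]; rewrite /unitary h1. Qed.

(** For a reflection Q, the Lindblad generator with jump operator sqrt c Q. *)
Definition mixgen (c : R) (Q x : E) : E := c%:C *: (Q *m x *m Q - x).

(** For 0 <= q <= 1 and a reflection Q, the channel that applies Q with probability q. *)
Definition mix (q : R) (Q x : E) : E := (1 - q)%:C *: x + q%:C *: (Q *m x *m Q).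

Lemma clin_mixgen c Q : clin (mixgen c Q).
Proof.
apply: clin_scale; apply: clin_add; first exact: clin_mul.
by apply: clin_opp; exact: clin_id.
Qed.

Lemma nrm_reflection Q x : reflection Q -> nrm (Q *m x *m Q) = nrm x.
Proof.
by move=> h; rewrite -{2}h.1 nrm_sandwich //; exact: reflection_unitary.
Qed.

(** Conjugation by Q is an isometry, so Cauchy-Schwarz bounds [ip x (Q *m x *m Q)] by
    [nrm x ^+ 2]. *)
Lemma dissipative_mixgen c Q : 0 <= c -> reflection Q -> dissipative (mixgen c Q).
Proof.
move=> c0 hQ x; rewrite /mixgen ipZr mulr_ge0_le0 // ipDr ipNr subr_le0.
by rewrite (le_trans (ip_le _ _)) // nrm_reflection // -expr2 nrm_sq.
Qed.

Lemma nrm_mix q Q x : 0 <= q <= 1 -> reflection Q -> nrm (mix q Q x) <= nrm x.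
Proof.
move=> /andP[q0 q1] hQ; apply: (le_trans (nrmD _ _)).
rewrite !nrmZR nrm_reflection // !ger0_norm ?subr_ge0 //.
by rewrite -mulrDl subrK mul1r.
Qed.

(** Conjugation by Q is an involution, so the ansatz [mix (q s) Q x] reduces the equation to q' = c
    (1 - 2 q) with initial value 0. *)
Lemma flow_mixgen c Q t x : 0 <= c -> reflection Q -> 0 <= t ->
  flow (mixgen c Q) t x = mix ((1 - expR (- (2 * c * t))) / 2) Q x.
Proof.
move=> c0 hQ t0; pose q s := (1 - expR (- (2 * c * s))) / 2.
have dq s : is_derive s (1 : R) q (c * expR (- (2 * c * s))).
  have h1 : is_derive s (1 : R) (fun s : R => - (2 * c * s)) (- (2 * c)).
    apply: is_derive_ext (is_deriveZ (- (2 * c)) (is_derive_id s (1:R))) => [u|].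
      exact: mulNr.
    by rewrite /GRing.scale /= mulr1.
  have h2 : is_derive s (1 : R) (fun s : R => expR (- (2 * c * s))) (expR (- (2 * c * s)) * - (2 * c)).
    exact: (@is_derive1_comp R _ _ s _ _ (is_derive_expR (- (2 * c * s))) h1).
  apply: is_derive_ext (is_deriveZ (- (1 / 2)) (is_deriveD h2 (is_derive_cst (-1 : R) s (1:R)))) => [u|].
    by transitivity (- (1 / 2) * (expR (- (2 * c * u)) + -1)) => //; rewrite /q; field.
  by rewrite /GRing.scale /=; field.
have dF s : mder (fun u => mix (q u) Q x) s (mixgen c Q (mix (q s) Q x)).
  have h1 : is_derive s (1 : R) (fun u => 1 - q u) (- (c * expR (- (2 * c * s)))).
    apply: is_derive_ext (is_deriveB (is_derive_cst (1:R) s (1:R)) (dq s)) => //.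
    by rewrite sub0r.
  apply: mder_eq (mderD (mder_scal x h1) (mder_scal (Q *m x *m Q) (dq s))) _.
  have [_ QQ] := hQ.
  have QxQ : Q *m (Q *m x *m Q) *m Q = x.
    by rewrite !mulmxA QQ mul1mx -mulmxA QQ mulmx1.
  rewrite /mixgen /mix mulmxDr mulmxDl -!scalemxAr -!scalemxAl QxQ.
  have -> : c * expR (- (2 * c * s)) = c * (1 - 2 * q s) by rewrite /q; field.
  move: (q s) (Q *m x *m Q) => r y; apply/matrixP => i j; rewrite !mxE.
  by rewrite !(rmorphN, rmorphM, rmorphB, rmorph1, rmorph_nat); ring.
have := mder_unique (clin_mixgen c Q) (dissipative_mixgen c0 hQ) t0 dF.
move=> ->; congr (flow _ _ _); rewrite /mix /q mulr0 oppr0 expR0 subrr mul0r.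
by rewrite subr0 scale1r scale0r addr0.
Qed.

Section Invariant.
Variable FF : E -> R -> Prop.
Hypothesis FF_unitary : forall U M c, unitary U -> FF M c -> FF (dagger U *m M *m U) c.

(** [FF M c] selects the half-space with normal vector M and bound c. Intersections of such are
    closed and convex, which gives stability under limits and mixing. *)
Definition halfspaces (x : E) := is_hermitian x /\ forall M c, FF M c -> ip M x <= c.

Definition preserving (F : E -> E) := nonexpansive F /\ forall x, halfspaces x -> halfspaces (F x).

Lemma nrm_dagger (x : E) : nrm (dagger x) = nrm x.
Proof. by rewrite !nrmE /ip daggerK mxtrace_mulC. Qed.

Lemma halfspaces_closed x : (forall e : R, 0 < e -> exists2 y, halfspaces y & nrm (x - y) <= e) ->
  halfspaces x.
Proof.
move=> h; split.
  apply/eqP; rewrite -subr_eq0; apply/eqP; apply: nrm_eq0; apply/eqP.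
  rewrite eq_le nrm_ge0 andbT; apply/ler_addgt0Pr => e e0; rewrite add0r.
  have e2 : 0 < e / 2 by lra.
  have [y [hy _] hxy] := h _ e2.
  apply: (le_trans (nrm_triangle y _ _)).
  by rewrite -{1}hy -daggerB nrm_dagger (nrmBC y); lra.
move=> M c hM; apply/ler_addgt0Pr => e e0.
have D0 : 0 < nrm M + 1 by have := nrm_ge0 M; lra.
have [y [_ hy] hxy] := h (e / (nrm M + 1)) (divr_gt0 e0 D0).
rewrite -[x](subrK y) ipDr addrC lerD ?hy // (le_trans (ip_le _ _)) //.
apply: (le_trans (ler_wpM2l (nrm_ge0 M) hxy)).
rewrite mulrA ler_pdivrMr // mulrC ler_wpM2l ?(ltW e0) //.
by rewrite lerDl.
Qed.

Lemma preserving_closed_semigroup : closed_semigroup preserving.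
Proof.
split.
- by split=> //; split.
- move=> S S' [[a1 a2] a3] [[b1 b2] b3]; split; last by move=> x hx; apply: a3; exact: b3.
  by split=> [|x y]; [rewrite b1 a1|rewrite (le_trans (a2 _ _))].
- by move=> S [].
move=> F h; split.
  by apply: nonexpansive_limit => e e0; have [S [hS _] hS'] := h e e0; exists S.
move=> x hx; apply: halfspaces_closed => e e0.
have D0 : 0 < nrm x + 1 by have := nrm_ge0 x; lra.
have [S [_ hS] hS'] := h (e / (nrm x + 1)) (divr_gt0 e0 D0).
exists (S x); first exact: hS.
apply: (le_trans (hS' x)); rewrite mulrAC ler_pdivrMr // ler_wpM2l ?(ltW e0) //.
by rewrite lerDl.
Qed.

Lemma halfspaces_sandwich U x : unitary U -> halfspaces x -> halfspaces (U *m x *m dagger U).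
Proof.
move=> hU [h1 h2]; split; first by rewrite /is_hermitian !dagger_mul daggerK h1 mulmxA.
by move=> M c hM; rewrite ip_sandwich; apply: h2; exact: FF_unitary.
Qed.

Lemma halfspaces_mix q Q x : 0 <= q <= 1 -> reflection Q -> halfspaces x -> halfspaces (mix q Q x).
Proof.
move=> /andP[q0 q1] hQ hx; have := halfspaces_sandwich (reflection_unitary hQ) hx.
rewrite hQ.1; case: hx => h1 h2 [h3 h4]; split.
  by rewrite /is_hermitian daggerD !daggerZ !conjc_real h1 h3.
move=> M c hM; rewrite ipDr !ipZr.
have := h2 M c hM; have := h4 M c hM => a1 a2.
have p1 : q * ip M (Q *m x *m Q) <= q * c by rewrite ler_wpM2l.
have p2 : (1 - q) * ip M x <= (1 - q) * c by rewrite ler_wpM2l // subr_ge0.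
lra.
Qed.

(** The Hamiltonian flow conjugates by a unitary and the noise flow mixes with a reflected copy;
    each preserves the set. Both generators are therefore tangent, and their sum integrates to a
    preserving flow. *)
Lemma preserving_flow A c Q t : dagger A = - A -> 0 <= c -> reflection Q -> 0 <= t ->
  preserving (flow (fun x => ad A x + mixgen c Q x) t).
Proof.
move=> hA c0 hQ t0; have hSS := preserving_closed_semigroup.
have tA : tangent preserving (ad A).
  apply: (tangent_of_flow (clin_ad A)) => s s0.
  have [W hW hfl] := flow_ad_unitary hA s0; split.
    apply: nonexpansive_clin => [|x]; first by apply: flow_clin; exact: clin_ad.
    by rewrite hfl nrm_sandwich.
  by move=> x hx; rewrite hfl; exact: halfspaces_sandwich.
have tQ : tangent preserving (mixgen c Q).
  apply: (tangent_of_flow (clin_mixgen c Q)) => s s0.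
  have q01 : 0 <= (1 - expR (- (2 * c * s))) / 2 <= 1.
    have := expR_gt0 (- (2 * c * s)).
    have : expR (- (2 * c * s)) <= 1.
      by rewrite -expR0 ler_expR oppr_le0 !mulr_ge0.
    by move=> a1 a2; apply/andP; split; lra.
  split.
    apply: nonexpansive_clin => [|x]; first by apply: flow_clin; exact: clin_mixgen.
    by rewrite flow_mixgen // nrm_mix.
  by move=> x hx; rewrite flow_mixgen //; exact: halfspaces_mix.
have hL : clin (fun x => ad A x + mixgen c Q x) := clin_add (clin_ad A) (clin_mixgen c Q).
have hd : dissipative (fun x => ad A x + mixgen c Q x).
  by move=> x; rewrite ipDr ip_ad // add0r; exact: dissipative_mixgen.
have ht := tangent_add hSS (clin_ad A) (clin_mixgen c Q) tA tQ.
exact: (flow_of_tangent hSS hL hd ht t0).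
Qed.

End Invariant.

(** In finite dimension entrywise and norm approximation agree, up to the factor N^2. *)
Lemma mx_closure_nrm (S : E -> Prop) A :
  mx_closure S A <-> forall e : R, 0 < e -> exists2 B, S B & nrm (A - B) <= e.
Proof.
have entry (A' B : E) (e : R) i j : (`|A' i j - B i j| < e%:C) = (modc ((A' - B) i j) < e).
  by rewrite normE ltcR !mxE.
split=> h e e0.
  have D0 : 0 < (N * N)%:R + 1 :> R by rewrite ltr_wpDl.
  have [B [SB hB]] := h (e / ((N * N)%:R + 1)) (divr_gt0 e0 D0); exists B => //.
  have /nrm_entries : forall i j, modc ((A - B) i j) <= e / ((N * N)%:R + 1).
    by move=> i j; have := hB i j; rewrite entry => /ltW.
  move/le_trans; apply; rewrite mulrA ler_pdivrMr // mulrC ler_wpM2l ?(ltW e0) //.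
  by rewrite lerDl.
have e2 : 0 < e / 2 by lra.
have [B SB hB] := h _ e2; exists B; split=> // i j; rewrite entry.
by apply: (le_lt_trans (modc_entry _ i j)); lra.
Qed.

End Mixing.

(** * Traceless reflections and their action as T-transforms *)

Section Reflections.
Variable R : realType.
Local Notation C := R[i].

Lemma perm_eq_signs (s : seq R) : (forall x, x \in s -> x ^+ 2 = 1) ->
  exists p q, perm_eq s (nseq p 1 ++ nseq q (-1)).
Proof.
elim: s => [|x s ih] h; first by exists 0%N, 0%N.
have [|p [q hpq]] := ih; first by move=> y hy; apply: h; rewrite inE hy orbT.
have := h x; rewrite inE eqxx => /(_ isT) /eqP; rewrite sqrf_eq1 => /orP[] /eqP ->.
  by exists p.+1, q; rewrite /= perm_cons.
exists p, q.+1; rewrite /= -cat1s perm_sym -[_ :: _]cat1s perm_catCA perm_cat2l.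
by rewrite perm_sym.
Qed.

(** The length p + q and the sum p - q determine how often each sign occurs. *)
Lemma perm_eq_signs2 (s t : seq R) : (forall x, x \in s -> x ^+ 2 = 1) ->
  (forall x, x \in t -> x ^+ 2 = 1) -> size s = size t ->
  \sum_(x <- s) x = \sum_(x <- t) x -> perm_eq s t.
Proof.
move=> /perm_eq_signs [p [q hs]] /perm_eq_signs [p' [q' ht]] hsz hsum.
have sumE (a b : nat) : \sum_(x <- nseq a (1 : R) ++ nseq b (-1)) x = a%:R - b%:R.
  by rewrite big_cat !big_nseq !iter_addr_0 mulNrn.
move: hsz hsum; rewrite (perm_size hs) (perm_size ht) (perm_big _ hs) (perm_big _ ht) /=.
rewrite !sumE !size_cat !size_nseq => e1 e2.
have e3 : p%:R + q%:R = p'%:R + q'%:R :> R by rewrite -!natrD e1.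
have /eqP : p%:R = p'%:R :> R by lra.
rewrite eqr_nat => /eqP e4; move: e1; rewrite e4 => /addnI e5.
by rewrite (perm_trans hs) // e4 e5 perm_sym.
Qed.

Variable N : nat.
Local Notation E := 'M[C]_N.

Lemma reflection_spectrum (Q : E) : reflection Q ->
  exists s, [/\ eigvals_of Q s, (forall x, x \in s -> x ^+ 2 = 1), size s = N & \tr Q = (\sum_(x <- s) x)%:C].
Proof.
move=> [h1 h2]; have [U [d [hU hd]]] := spectral_hermitian h1.
exists [seq d i | i <- enum 'I_N]; split.
- exact: eigvals_of_dg hd.
- move=> x /mapP [i _ ->].
  have /matrixP /(_ i i) : dg d *m dg d = 1%:M.
    have e := diag_mx_conj hU hd; rewrite -/(dg d) in e.
    by rewrite e !mulmxA -(mulmxA _ U) (unitaryV hU) mulmx1 -(mulmxA _ Q Q) h2 mulmx1 hU.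
  rewrite mulmx_diag !mxE eqxx mulr1n -rmorphM => /complexI.
  by rewrite expr2.
- by rewrite size_map size_enum_ord.
- rewrite hd mxtrace_mulC mulmxA hU mul1mx mxtrace_diag big_map big_enum rmorph_sum.
  by apply: eq_bigr => i _; rewrite mxE.
Qed.

(** The eigenvalues are 1 and -1, and the trace fixes their multiplicities. *)
Lemma reflection_similar (Q Q' : E) : reflection Q -> reflection Q' -> \tr Q = \tr Q' ->
  exists2 U, unitary U & Q' = U *m Q *m dagger U.
Proof.
move=> hQ hQ' tQ.
have [s [e1 s1 z1 t1]] := reflection_spectrum hQ.
have [s' [e2 s2 z2 t2]] := reflection_spectrum hQ'.
have st : perm_eq s' s.
  apply: perm_eq_signs2 => //; first by rewrite z1 z2.
  by apply: (@complexI R); rewrite -t1 -t2 tQ.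
have [U hU hd] := eigvals_diagonalize hQ.1 e1.
have [U' hU' hd'] := eigvals_diagonalize hQ'.1 (eigvals_of_perm st e2).
exists (U' *m dagger U); first by apply: unitary_mul => //; exact: unitary_dagger.
rewrite hd hd' dagger_mul daggerK !mulmxA -(mulmxA _ (dagger U)) hU mulmx1.
by rewrite -(mulmxA _ (dagger U) U) hU mulmx1.
Qed.

(* A reflection exchanging the basis vectors i and j and acting diagonally on the others
   with signs [sg]; it implements the T-transforms of the pair (i, j). *)
Definition swap_reflection (i j : 'I_N) (sg : 'I_N -> R) : E :=
  perm_mx (tperm i j) *m dg sg.

Section Swap.
Variables (i j : 'I_N) (sg : 'I_N -> R).
Hypothesis sg_sq : forall k, sg k ^+ 2 = 1.
Hypothesis sg_swap : forall k, sg (tperm i j k) = sg k.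

Lemma dg_mul d e : dg d *m dg e = dg (fun k : 'I_N => d k * e k) :> E.
Proof. by rewrite mulmx_diag; congr diag_mx; apply/rowP => k; rewrite !mxE rmorphM. Qed.

Lemma dagger_dg d : dagger (dg d) = dg d :> E.
Proof. by rewrite dagger_diag; congr diag_mx; apply/rowP => k; rewrite !mxE conjc_real. Qed.

Lemma swap_sandwich d : swap_reflection i j sg *m dg d *m dagger (swap_reflection i j sg) =
  dg (fun k => d (tperm i j k)).
Proof.
rewrite /swap_reflection dagger_mul dagger_dg !mulmxA.
rewrite -(mulmxA (perm_mx _)) dg_mul -(mulmxA (perm_mx _)) dg_mul dg_perm.
congr (_ *m dg _ *m _); apply/funext => k.
by rewrite mulrAC -expr2 sg_sq mul1r.
Qed.

(** The signs agree on the exchanged pair, so the diagonal factor commutes with the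
    transposition. *)
Lemma swap_hermitian : is_hermitian (swap_reflection i j sg).
Proof.
rewrite /is_hermitian /swap_reflection dagger_mul dagger_dg.
have h : dg sg = perm_mx (tperm i j) *m dg sg *m dagger (perm_mx (tperm i j)).
  by rewrite -dg_perm; congr dg; apply/funext => k; rewrite sg_swap.
rewrite {1}h -mulmxA.
have -> : dagger (perm_mx (tperm i j)) = perm_mx (tperm i j) :> E.
  by rewrite /dagger map_perm_mx tr_perm_mx tpermV.
by rewrite -perm_mxM tperm2 perm_mx1 mulmx1.
Qed.

Lemma swap_is_reflection : reflection (swap_reflection i j sg).
Proof.
split; first exact: swap_hermitian.
have h1 : dg (fun=> 1) = 1%:M :> E.
  by apply/matrixP => k l; rewrite !mxE.
have := swap_sandwich (fun=> 1).
by rewrite h1 swap_hermitian mulmx1.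
Qed.

Lemma mix_swap q (d : nat -> R) : i != j ->
  mix q (swap_reflection i j sg) (dg (fun k : 'I_N => d k)) =
  dg (fun k : 'I_N => t_transform i j q d k).
Proof.
move=> ij; rewrite /mix; have := swap_sandwich (fun k => d k); rewrite swap_hermitian => ->.
apply/matrixP => k l; rewrite !mxE; have [_|] := eqVneq k l; last by move=> _; rewrite !mulr0n !mulr0 addr0.
have ve (a b : 'I_N) : (nat_of_ord a == nat_of_ord b) = (a == b) by [].
rewrite !mulr1n -!rmorphM -rmorphD /t_transform !ve.
have [-> | ki] := eqVneq k i; first by rewrite tpermL.
have [-> | kj] := eqVneq k j; first by rewrite tpermR.
rewrite tpermD 1?eq_sym //.
by congr (_%:C); ring.
Qed.

Lemma trace_swap : i != j -> \tr (swap_reflection i j sg) =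
  (\sum_(k | (k != i) && (k != j)) sg k)%:C.
Proof.
move=> ij; rewrite /swap_reflection /mxtrace rmorph_sum [RHS]big_mkcond; apply: eq_bigr => k _.
rewrite -row_permE !mxE.
have [->|ki] := eqVneq k i; first by rewrite tpermL eq_sym (negPf ij).
have [->|kj] := eqVneq k j; first by rewrite tpermR (negPf ij).
by rewrite tpermD 1?eq_sym // eqxx.
Qed.
End Swap.

Lemma alternating_sum M : \sum_(k < 2 * M) ((-1) ^+ k : R) = 0.
Proof.
elim: M => [|M ih]; first by rewrite big_ord0.
by rewrite mulnS addSn addSn add0n !big_ord_recr /= ih exprS mul2n -signr_odd odd_double; ring.
Qed.

(** The positions i and j contribute nothing to the trace. The other signs alternate along an
    enumeration starting with i and j, and cancel because N is even. *)
Lemma swap_reflection_exists (i j : 'I_N) : ~~ odd N -> i != j ->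
  exists2 Q : E, reflection Q /\ \tr Q = 0 &
    forall q (d : nat -> R), mix q Q (dg (fun k : 'I_N => d k)) = dg (fun k : 'I_N => t_transform i j q d k).
Proof.
move=> evN ij.
have N1 : (1 < N)%N.
  by case: N i j ij evN => [[]//|[|//]] [[|//] a] [[|//] b]; rewrite -val_eqE.
pose o0 := Ordinal (ltnW N1); pose o1 := Ordinal N1.
(* p sends i to 0 and j to 1: the second transposition corrects the image of j and fixes 0. *)
pose p := (tperm i o0 * tperm (tperm i o0 j) o1)%g.
have p_i : p i = o0.
  rewrite permM tpermL tpermD // -(inj_eq (@perm_inj _ (tperm i o0))) tpermK tpermR eq_sym //.
have pj : p j = o1 by rewrite permM tpermL.
(* Equal signs at i and j are what makes the swap Hermitian. *)
pose sg k : R := if (k == i) || (k == j) then 1 else (-1) ^+ p k.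
have sg_sq k : sg k ^+ 2 = 1.
  by rewrite /sg; case: ifP => _; rewrite ?expr1n // sqrr_sign.
have sg_swap k : sg (tperm i j k) = sg k.
  by rewrite /sg; case: tpermP => [->|->|]; rewrite ?eqxx ?orbT.
exists (swap_reflection i j sg); last by move=> q d; apply: mix_swap.
split; first exact: swap_is_reflection.
rewrite trace_swap //.
have h : \sum_k ((-1) ^+ p k : R) = 0.
  have -> : \sum_k ((-1) ^+ p k : R) = \sum_(k < N) (-1) ^+ k.
    by rewrite [RHS](reindex_inj (@perm_inj _ p)).
  by have := alternating_sum N./2; rewrite mul2n even_halfK.
rewrite (bigD1 i) //= (bigD1 j) 1?eq_sym //= p_i pj /= expr0 expr1 addrA subrr add0r in h.
rewrite (eq_bigr (fun k => (-1) ^+ p k)) ?h // => k /andP[/negPf ki /negPf kj].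
by rewrite /sg ki kj.
Qed.

End Reflections.

(** * The bit-flip operator and the generator of the control system *)

Section BitFlip.
Variables (R : realType) (n : nat).
Local Notation C := R[i].
Local Notation E := 'M[C]_(2 ^ n).

(** Flips the last bit b of i = 2 a + b. *)
Definition flipn (i : nat) : nat := if odd i then i.-1 else i.+1.

Lemma flipnK i : flipn (flipn i) = i.
Proof. by rewrite /flipn; case: (boolP (odd i)) => h; [case: i h => //= i h; rewrite (negPf h)|rewrite /= h]. Qed.

Lemma flipnP i j : (i./2 == j./2)%N && (odd i != odd j) = (j == flipn i).
Proof.
rewrite /flipn; have ei := odd_double_half i; have ej := odd_double_half j.
apply/idP/eqP.
  move=> /andP[/eqP h1]; move: ei ej; rewrite h1 -!muln2.
  by case: (odd i); case: (odd j) => //= ei ej _; lia.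
case: ifP => h ->.
  by case: i h ei => //= i h _; rewrite uphalf_half (negPf h) eqxx.
by rewrite /= h uphalf_half h /= add0n eqxx.
Qed.

Definition bitflip : E := \matrix_(i, j) (nat_of_ord j == flipn i)%:R.

Lemma Vb_bitflip : Vb R n = ((Num.sqrt (2 : R))^-1)%:C *: bitflip.
Proof.
by apply/matrixP => i j; rewrite !mxE flipnP; case: eqP; rewrite ?mulr1 ?mulr0.
Qed.

Hypothesis n_gt0 : (1 <= n)%N.

(** For n >= 1 the number 2^n is even, so an even index below it also has its successor below it. *)
Lemma flipn_lt (i : 'I_(2 ^ n)) : (flipn i < 2 ^ n)%N.
Proof.
rewrite /flipn; case: ifP => h; first by rewrite (leq_ltn_trans (leq_pred _)).
rewrite ltn_neqAle ltn_ord andbT; apply/negP => /eqP e.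
by have := congr1 odd e; rewrite /= h oddX; case: n n_gt0.
Qed.

Lemma bitflip_reflection : reflection bitflip.
Proof.
split.
  apply/matrixP => i j; rewrite !mxE rmorph_nat; congr (_%:R).
  by congr nat_of_bool; apply/eqP/eqP => ->; rewrite flipnK.
apply/matrixP => i j; rewrite !mxE (bigD1 (Ordinal (flipn_lt i))) //= big1 ?addr0.
  by rewrite !mxE eqxx mul1r flipnK eq_sym.
by move=> k hk; rewrite !mxE -val_eqE /= in hk *; rewrite (negPf hk) mul0r.
Qed.

Lemma bitflip_trace : \tr bitflip = 0.
Proof.
rewrite /mxtrace big1 // => i _; rewrite mxE /flipn.
case: ifP => h; last by rewrite eqn_leq ltnn andbF.
by case: (nat_of_ord i) h => //= k _; rewrite eqn_leq ltnn.
Qed.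

(** The flip squares to 1 and V_b carries the factor 1 / sqrt 2, so the noise is mixing at rate g /
    2. *)
Lemma lindblad_genE m (H0 : E) (H : 'I_m -> E) u (g : R) x :
  lindblad_gen H0 H u g x = ad (- (iu R *: Hu H0 H u)) x + mixgen (g / 2) bitflip x.
Proof.
have s2 : Num.sqrt (2 : R) * Num.sqrt 2 = 2 by rewrite -expr2 sqr_sqrtr.
have s2n : Num.sqrt (2 : R) != 0 by rewrite gt_eqF // sqrtr_gt0.
have c2 : ((Num.sqrt (2 : R))^-1)%:C * ((Num.sqrt (2 : R))^-1)%:C = (2 : C)^-1.
  by rewrite -rmorphM -invfM s2 fmorphV rmorph_nat.
have [hX XX] := bitflip_reflection.
rewrite /lindblad_gen opprD ad_opp; congr (_ + _).
  by rewrite /ad /lie_bracket scalerBr -scalemxAl -scalemxAr.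
rewrite /Gamma_b Vb_bitflip daggerZ conjc_real hX.
rewrite -!scalemxAl -!scalemxAr -!scalemxAl !scalerA c2 XX mul1mx mulmx1.
rewrite scalerN opprK /mixgen rmorphM fmorphV rmorph_nat -scalerA; congr (_ *: _).
by apply/matrixP => i j; rewrite !mxE; field; rewrite ?pnatr_eq0.
Qed.

End BitFlip.

(** * Reachable states as products of flows *)

Section Reach.
Variables (R : realType) (n m : nat).
Local Notation C := R[i].
Local Notation E := 'M[C]_(2 ^ n).
Local Notation Re := (@complex.Re R).
Local Notation Im := (@complex.Im R).
Variables (H0 : E) (H : 'I_m -> E) (gstar : R).
Hypothesis n_gt0 : (1 <= n)%N.
Hypothesis H0_herm : is_hermitian H0.
Hypothesis H_herm : forall j, is_hermitian (H j).
Hypothesis gstar_gt0 : 0 < gstar.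

(** The default piece of [start_time] and [reach_set]; its zero duration makes [start_time] constant
    beyond the end of the list. *)
Definition piece0 : ctrl_piece R m := (0, fun _ => 0, false).
Definition piece_gen (p : ctrl_piece R m) : E -> E :=
  lindblad_gen H0 H p.1.2 (if p.2 then gstar else 0).
Definition piece_flow (p : ctrl_piece R m) : E -> E := flow (piece_gen p) p.1.1.
Definition run (ps : seq (ctrl_piece R m)) (x : E) : E := foldl (fun y p => piece_flow p y) x ps.
Definition valid (ps : seq (ctrl_piece R m)) : bool := all (fun p => 0 <= p.1.1) ps.

Lemma piece_rate_ge0 (b : bool) : 0 <= (if b then gstar else 0) / 2.
Proof. by case: b; [rewrite divr_ge0 ?(ltW gstar_gt0)|rewrite mul0r]. Qed.

Lemma skew_Hu u : dagger (- (iu R *: Hu H0 H u)) = - - (iu R *: Hu H0 H u).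
Proof.
have hi : ((iu R)^*)%C = - iu R by apply: complex_eqP => /=; rewrite ?oppr0.
have hH : is_hermitian (Hu H0 H u).
  rewrite /is_hermitian /Hu daggerD H0_herm; congr (_ + _).
  rewrite (big_morph (@dagger R _ _) (@daggerD R _ _) (id1 := 0)); last first.
    by rewrite /dagger map_mx0 trmx0.
  by apply: eq_bigr => j _; rewrite daggerZ conjc_real H_herm.
by rewrite daggerN daggerZ hi hH scaleNr.
Qed.

Lemma piece_genE p : piece_gen p = fun x => ad (- (iu R *: Hu H0 H p.1.2)) x +
  mixgen ((if p.2 then gstar else 0) / 2) (bitflip R n) x.
Proof. by apply/funext => x; exact: lindblad_genE. Qed.

Lemma clin_piece p : clin (piece_gen p).
Proof. by rewrite piece_genE; apply: clin_add; [exact: clin_ad|exact: clin_mixgen]. Qed.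

Lemma dissipative_piece p : dissipative (piece_gen p).
Proof.
rewrite piece_genE => x; rewrite ipDr ip_ad ?skew_Hu // add0r.
by apply: dissipative_mixgen; [exact: piece_rate_ge0|exact: bitflip_reflection].
Qed.

(** Needed for gluing. Equality on the closed interval suffices, since derivatives are asked for
    only at interior points, where it holds in a neighbourhood. *)
Lemma solves_on_ext (L : E -> E) (f g : R -> E) (a b : R) :
  (forall t, a <= t <= b -> f t = g t) -> solves_on L f a b -> solves_on L g a b.
Proof.
move=> fg hf i j; have [h1 [h2 h3]] := hf i j; split; [|split].
- refine (subspace_eq_continuous _ h1) => t /set_mem; rewrite /= in_itv /= => ht.
  by rewrite /from_subspace (fg t ht).
- refine (subspace_eq_continuous _ h2) => t /set_mem; rewrite /= in_itv /= => ht.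
  by rewrite /from_subspace (fg t ht).
move=> t ht; have [d1 d2] := h3 t ht.
have nr : \near t, f t = g t.
  have : t \in `]a, b[%R by rewrite in_itv.
  move/near_in_itvoo; apply: filterS => s; rewrite in_itv /= => /andP[/ltW s1 /ltW s2].
  by apply: fg; rewrite s1.
have tt : a <= t <= b by case/andP: ht => /ltW -> /ltW ->.
rewrite -(fg t tt); split.
  by apply: near_eq_is_derive d1; near=> s; rewrite (near nr s).
by apply: near_eq_is_derive d2; near=> s; rewrite (near nr s).
Unshelve. all: by end_near. Qed.

Lemma start_timeS (ps : seq (ctrl_piece R m)) k :
  start_time ps k.+1 = start_time ps k + (nth piece0 ps k).1.1.
Proof. by rewrite /start_time big_ord_recr. Qed.

Lemma valid_nth ps k : valid ps -> 0 <= (nth piece0 ps k).1.1.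
Proof.
move=> h; have [kl|lk] := ltnP k (size ps); first exact: (all_nthP piece0 h).
by rewrite nth_default.
Qed.

Lemma start_time_le ps k l : valid ps -> (k <= l)%N -> start_time ps k <= start_time ps l.
Proof.
move=> h /subnKC <-; elim: (l - k)%N => [|d ih]; first by rewrite addn0.
by rewrite addnS start_timeS (le_trans ih) // lerDl valid_nth.
Qed.

Lemma run_rcons ps p x : run (rcons ps p) x = piece_flow p (run ps x).
Proof. by rewrite /run foldl_rcons. Qed.

Lemma run_cat ps qs x : run (ps ++ qs) x = run qs (run ps x).
Proof. by rewrite /run foldl_cat. Qed.

Lemma nrm_run_sub ps x y : valid ps -> nrm (run ps x - run ps y) <= nrm (x - y).
Proof.
elim/last_ind: ps => // ps p ih; rewrite /valid all_rcons => /andP[p0 hps].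
rewrite !run_rcons /piece_flow -(clinB (flow_clin (clin_piece p) _)).
by rewrite (le_trans (flow_contract _ (clin_piece p) (dissipative_piece p) p0)) // ih.
Qed.

Lemma run0 ps : run ps 0 = 0.
Proof.
elim/last_ind: ps => // ps p ih; rewrite run_rcons ih.
by apply: clin0; exact: flow_clin (clin_piece p) _.
Qed.

(** A trajectory for the earlier pieces is continued past its end time T by the flow of the last
    piece, started at f T. *)
Lemma reach_run ps x : valid ps -> reach_set H0 H gstar x (run ps x).
Proof.
move=> hps; exists ps.
suff [f [f0 f1 f2]] : exists f : R -> E, [/\ f 0 = x,
   f (start_time ps (size ps)) = run ps x &
   forall k, (k < size ps)%N ->
     solves_on (piece_gen (nth piece0 ps k)) f (start_time ps k) (start_time ps k.+1)].
  by exists f; split=> // k kl; exact: valid_nth.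
elim/last_ind: ps hps => [|ps p ih] /=.
  by move=> _; exists (fun=> x); split=> //.
move=> hv; have := hv; rewrite /valid all_rcons => /andP[p0 hps].
have [f [f0 f1 f2]] := ih hps.
pose T := start_time ps (size ps).
have stE k : (k <= size ps)%N -> start_time (rcons ps p) k = start_time ps k.
  move=> kl; apply: eq_bigr => l _; rewrite nth_rcons.
  by rewrite (leq_trans (ltn_ord l) kl).
have stT : start_time (rcons ps p) (size ps).+1 = T + p.1.1.
  by rewrite start_timeS stE // nth_rcons ltnn eqxx.
pose g t := if t <= T then f t else flow (piece_gen p) (t - T) (f T).
have T0 : 0 <= T.
  have -> : 0 = start_time ps 0 :> R by rewrite /start_time big_ord0.
  exact: start_time_le.
(* The two branches agree at T, as the flow at time 0 is the identity. *)
have gT t : T <= t -> g t = flow (piece_gen p) (t - T) (f T).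
  rewrite /g le_eqVlt => /orP[/eqP <-|ht]; first by rewrite lexx subrr fl0.
  by rewrite leNgt ht.
exists g; split.
- by rewrite /g T0.
- by rewrite size_rcons stT gT ?lerDl // addrC addKr run_rcons /piece_flow f1.
move=> k; rewrite size_rcons ltnS leq_eqVlt => /orP[/eqP ->|kl].
  rewrite stT stE // nth_rcons ltnn eqxx.
  apply: (@solves_on_ext _ (fun t => flow (piece_gen p) (t - T) (f T))).
    by move=> t /andP[ht _]; rewrite gT.
  by apply: mder_solves_on => t; apply: mder_flow_shift; exact: clin_piece.
rewrite !stE // 1?ltnW // nth_rcons kl.
apply: solves_on_ext (f2 k kl) => t /andP[_ ht].
by rewrite /g (le_trans ht) // start_time_le.
Qed.

(** On every piece the solution is unique, hence given by the flow; induction over the switching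
    times. *)
Lemma reach_is_run x y : reach_set H0 H gstar x y -> exists2 ps, valid ps & y = run ps x.
Proof.
move=> [ps [f [h1 h2 <- h3]]]; exists ps.
  by apply/(all_nthP piece0) => k kl; exact: h1.
suff h k : (k <= size ps)%N -> f (start_time ps k) = run (take k ps) x.
  by rewrite h // take_size.
elim: k => [|k ih] kl; first by rewrite take0 /start_time big_ord0 h2.
rewrite (take_nth piece0 kl) run_rcons -ih ?(ltnW kl) //.
have d0 : 0 <= (nth piece0 ps k).1.1 by exact: h1.
have hle : start_time ps k <= start_time ps k.+1 by rewrite start_timeS lerDl.
rewrite (solves_flow (clin_piece _) (dissipative_piece _) hle (h3 k kl)).
by rewrite start_timeS addrC addKr.
Qed.

(** Closure in operator norm: one control has to serve all initial states at once, so that maps can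
    be composed. *)
Definition reachable_map (F : E -> E) := forall e : R, 0 < e ->
  exists2 ps, valid ps & forall x, nrm (F x - run ps x) <= e * nrm x.

Lemma reachable_map_run ps : valid ps -> reachable_map (run ps).
Proof.
by move=> h e e0; exists ps => // x; rewrite subrr nrm0 mulr_ge0 ?nrm_ge0 // ltW.
Qed.

Lemma nonexpansive_run ps : valid ps -> nonexpansive (run ps).
Proof. by move=> h; split; [exact: run0|move=> x y; exact: nrm_run_sub]. Qed.

Lemma nonexpansive_reachable F : reachable_map F -> nonexpansive F.
Proof.
move=> h; apply: nonexpansive_limit => e e0; have [ps hps hF] := h e e0.
by exists (run ps) => //; exact: nonexpansive_run.
Qed.

Lemma reachable_closed_semigroup : closed_semigroup reachable_map.
Proof.
split.
- exact: (@reachable_map_run [::]).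
- move=> F G hF hG e e0; have e2 : 0 < e / 2 by lra.
  have [ps vp hp] := hF _ e2; have [qs vq hq] := hG _ e2.
  (* [run] applies the head of the list first, so the control for G precedes that for F. *)
  exists (qs ++ ps); first by rewrite /valid all_cat; apply/andP.
  move=> x; rewrite run_cat.
  have a1 := nrm_triangle (F (run qs x)) (F (G x)) (run ps (run qs x)).
  have [_ nF] := nonexpansive_reachable hF.
  have a2 := le_trans (nF _ _) (hq x); have a3 := hp (run qs x).
  have a4 := nonexpansive_le x (nonexpansive_run vq).
  have a5 := ler_wpM2l (ltW e2) a4.
  move: a1 a2 a3 a5; lra.
- exact: nonexpansive_reachable.
move=> F h e e0; have e2 : 0 < e / 2 by lra.
have [S hS hF] := h _ e2; have [ps vp hp] := hS _ e2; exists ps => // x.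
have := nrm_triangle (S x) (F x) (run ps x); have := hF x; have := hp x; lra.
Qed.

Lemma reachable_piece p : 0 <= p.1.1 -> reachable_map (piece_flow p).
Proof. by move=> h; have := @reachable_map_run [:: p]; apply; rewrite /valid /= h. Qed.

End Reach.

(** * Ky Fan sums and majorization of spectra *)

Section KyFan.
Variables (R : realType) (N : nat).
Local Notation C := R[i].
Local Notation E := 'M[C]_N.
Local Notation Re := (@complex.Re R).
Local Notation Im := (@complex.Im R).

Lemma ip_dg (M : E) (d : 'I_N -> R) : ip M (dg d) = \sum_i Re (M i i) * d i.
Proof.
rewrite ipE; apply: eq_bigr => i _; rewrite (bigD1 i) //= big1 ?addr0.
  by rewrite dgE eqxx /= mulr0 addr0.
by move=> j /negPf hj; rewrite dgE eq_sym hj /= !mulr0 addr0.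
Qed.

Lemma trace_diagonalized (A U : E) (d : 'I_N -> R) : unitary U -> A = U *m dg d *m dagger U ->
  \tr A = (\sum_i d i)%:C.
Proof.
move=> hU ->; rewrite mxtrace_mulC mulmxA hU mul1mx mxtrace_diag rmorph_sum.
by apply: eq_bigr => i _; rewrite mxE.
Qed.

Lemma psd_diag (M : E) i : is_psd M -> 0 <= Re (M i i).
Proof.
move=> /(_ (delta_mx i 0)).
have -> : (dagger (delta_mx i 0 : 'cV[C]_N) *m M *m (delta_mx i 0 : 'cV[C]_N)) 0 0 = M i i.
  rewrite mxE (bigD1 i) //= big1 ?addr0 => [|j /negPf hj]; last first.
    by rewrite [delta_mx _ _ _ _]mxE hj mulr0.
  rewrite mxE (bigD1 i) //= big1 ?addr0 => [|j /negPf hj]; last first.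
    by rewrite !mxE hj rmorph0 mul0r.
  by rewrite !mxE !eqxx rmorph1 mul1r mulr1.
by rewrite lecE => /andP[_].
Qed.

Lemma psd_sandwich (M U : E) : is_psd M -> is_psd (dagger U *m M *m U).
Proof.
move=> h v; have := h (U *m v); rewrite dagger_mul !mulmxA; exact.
Qed.

Lemma psd_dg (d : 'I_N -> R) : (forall i, 0 <= d i) -> is_psd (dg d : E).
Proof.
move=> h v; rewrite mxE sumr_ge0 // => i _; rewrite mul_mx_diag !mxE mulrAC.
by rewrite mulr_ge0 ?ler0c // mulrC mulcJ_ge0.
Qed.

Lemma trace_outer (v : 'cV[C]_N) (A : E) : \tr (v *m dagger v *m A) = (dagger v *m A *m v) 0 0.
Proof. by rewrite -mulmxA mxtrace_mulC /mxtrace big_ord1. Qed.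

Variable s0 : seq R.

(* The sum of the k largest eigenvalues of x is the maximum of tr (M x) over the effects
   0 <= M <= 1 of trace k; the last three families encode positivity and trace 1. *)
Definition spectral_halfspace (M : E) (c : R) : Prop :=
  [\/ (is_hermitian M /\ is_psd M) /\ is_psd (1%:M - M) /\
        (exists k, [/\ (k <= N)%N, \tr M = k%:R & c = \sum_(l < k) s0`_l]),
      (exists v : 'cV[C]_N, M = - (v *m dagger v)) /\ c = 0,
      M = 1%:M /\ c = 1 | M = - 1%:M /\ c = -1].

Lemma spectral_halfspace_unitary U M c : unitary U -> spectral_halfspace M c ->
  spectral_halfspace (dagger U *m M *m U) c.
Proof.
move=> hU [[[h1 h2] [h3 [k [h4 h5 h6]]]]|[[v hv] hc]|[-> hc]|[-> hc]].
- apply: Or41; split.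
    by split; [rewrite /is_hermitian !dagger_mul daggerK h1 mulmxA|exact: psd_sandwich].
  split; last by exists k; split=> //; rewrite mxtrace_mulC mulmxA (unitaryV hU) mul1mx.
  have := psd_sandwich U h3; rewrite mulmxBr mulmxBl mulmx1 hU; exact.
- apply: Or42; split=> //; exists (dagger U *m v).
  by rewrite hv dagger_mul daggerK mulmxN mulNmx !mulmxA.
- by apply: Or43; rewrite mulmx1 hU.
- by apply: Or44; rewrite mulmxN mulNmx mulmx1 hU.
Qed.

(** Ky Fan's inequality: in an eigenbasis of [rho0] the diagonal of an effect M of trace k gives
    weights in [0, 1] with sum k, and [sum_le_top] applies. *)
Lemma density_halfspaces (rho0 : E) : is_density rho0 -> eigvals_of rho0 s0 ->
  sorted (fun x y : R => y <= x) s0 -> halfspaces spectral_halfspace rho0.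
Proof.
move=> [hh hp ht] he hs; split=> // M c.
have [U hU hd] := eigvals_diagonalize hh he.
case=> [[[h1 h2] [h3 [k [h4 h5 ->]]]]|[[v ->] ->]|[-> ->]|[-> ->]].
- rewrite hd ip_sandwich ip_dg; set M' := _ *m M *m U.
  have p1 i : 0 <= Re (M' i i) by apply: psd_diag; exact: psd_sandwich.
  have p2 i : Re (M' i i) <= 1.
    have : is_psd (1%:M - M') by have := psd_sandwich U h3; rewrite mulmxBr mulmxBl mulmx1 hU.
    by move=> /(@psd_diag _ i); rewrite !mxE eqxx Re_add Re_opp /= subr_ge0.
  have t1 : \sum_i Re (M' i i) = k%:R.
    rewrite -Re_sum -/(mxtrace M') mxtrace_mulC mulmxA (unitaryV hU) mul1mx h5.
    by rewrite -(rmorph_nat (real_complex R)).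
  (* Extended by 0 beyond N, to fit the functions on natural numbers of [sum_le_top]. *)
  pose w (l : nat) : R := if insub l is Some i then Re (M' i i) else 0.
  have wE (i : 'I_N) : w i = Re (M' i i) by rewrite /w valK.
  under eq_bigr do rewrite -wE mulrC.
  apply: sum_le_top => //.
  + move=> i j ij jN; have sz := eigvals_of_size he.
    apply: (sorted_leq_nth _ _ 0 hs) => //; rewrite ?inE ?sz //; last exact: leq_ltn_trans jN.
    by move=> a b d; exact: (fun x y => le_trans y x).
  + by move=> l lN; rewrite -[l]/(nat_of_ord (Ordinal lN)) wE p1 p2.
  + by rewrite -t1; apply: eq_bigr => i _; rewrite wE.
- rewrite ipNl /ip dagger_mul daggerK trace_outer oppr_le0.
  by have := hp v; rewrite lecE => /andP[].
- by rewrite /ip dagger1 mul1mx ht.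
- by rewrite ipNl /ip dagger1 mul1mx ht.
Qed.

(** The rank-one normal vectors return positivity and the pair 1, -1 returns the trace; Hermiticity
    removes the imaginary parts. *)
Lemma halfspaces_density (x : E) : halfspaces spectral_halfspace x -> is_density x.
Proof.
move=> [hh h]; split=> //.
  move=> v; rewrite lecE; apply/andP; split.
    have : dagger (dagger v *m x *m v) = dagger v *m x *m v.
      by rewrite !dagger_mul daggerK hh mulmxA.
    move/matrixP/(_ 0 0); rewrite mxE mxE => /(congr1 Im); rewrite Im_conjc /= => e.
    by apply/eqP; lra.
  have := h (- (v *m dagger v)) 0 (Or42 _ _ _ _); rewrite ipNl /ip dagger_mul daggerK trace_outer.
  by rewrite oppr_le0; apply; split=> //; exists v.
have a1 : ip 1%:M x <= 1 by apply: h; apply: Or43.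
have a2 : ip (- 1%:M) x <= -1 by apply: h; apply: Or44.
move: a1 a2; rewrite ipNl /ip dagger1 mul1mx => a1 a2.
apply: complex_eqP => /=; first lra.
by have := congr1 Im (trace_dagger x); rewrite hh Im_conjc; lra.
Qed.

(** The half-space of the projection onto the k leading eigenvectors of x bounds the k-th Ky Fan sum
    of x. *)
Lemma halfspaces_majorized (x rho0 : E) : is_density rho0 -> eigvals_of rho0 s0 ->
  sorted (fun x y : R => y <= x) s0 -> halfspaces spectral_halfspace x -> majorized_by x rho0.
Proof.
move=> [h0 p0 t0] he hs0 hx; have [hh h] := hx.
have [s hs ss] := sorted_eigvals hh.
have [U hU hd] := eigvals_diagonalize hh hs.
have [U0 hU0 hd0] := eigvals_diagonalize h0 he.
exists s, s0; split=> //.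
  move=> k kN; pose b (i : 'I_N) : R := (i < k)%N%:R.
  have sumb (f : nat -> R) : \sum_(l < k) f l = \sum_i b i * f i.
    rewrite (big_ord_widen N f kN) big_mkcond; apply: eq_bigr => l _.
    by rewrite /b; case: (l < k)%N; rewrite ?mul1r ?mul0r.
  have b0 i : 0 <= b i by exact: ler0n.
  have b1 i : 0 <= 1 - b i by rewrite /b; case: (i < k)%N; rewrite ?subrr ?subr0.
  have hM : spectral_halfspace (U *m dg b *m dagger U) (\sum_(l < k) s0`_l).
    apply: Or41; split; [split|split].
    - by rewrite /is_hermitian !dagger_mul daggerK dagger_dg mulmxA.
    - by rewrite -{1}(daggerK U); apply: psd_sandwich; exact: psd_dg.
    - have -> : 1%:M - U *m dg b *m dagger U = dagger (dagger U) *m dg (fun i => 1 - b i) *m dagger U.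
        have -> : dg (fun i => 1 - b i) = 1%:M - dg b :> E.
          by apply/matrixP => i j; rewrite !mxE; case: eqP => _; rewrite ?mulr1n ?mulr0n ?subr0 // rmorphB.
        by rewrite daggerK mulmxBr mulmxBl mulmx1 (unitaryV hU).
      by apply: psd_sandwich; exact: psd_dg.
    - exists k; split=> //; rewrite (trace_diagonalized hU erefl) -(rmorph_nat (real_complex R)); congr (_%:C).
      by have := sumb (fun=> 1); rewrite sumr_const card_ord => ->; apply: eq_bigr => i _; rewrite mulr1.
  have := h _ _ hM; rewrite hd ip_sandwich !mulmxA hU mul1mx -mulmxA hU mulmx1 ip_dg.
  rewrite (eq_bigr (fun i : 'I_N => b i * s`_i)) => [|i _]; last by rewrite dgE eqxx.
  by rewrite (sumb (fun l => s`_l)).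
have [_ _ tx] := halfspaces_density hx.
apply: (@complexI R).
by rewrite -(trace_diagonalized hU hd) -(trace_diagonalized hU0 hd0) tx t0.
Qed.

End KyFan.

(** * Controllability: reachable unitary conjugations and mixings *)

Lemma Hu0 (R : realType) (n m : nat) (H0 : 'M[R[i]]_(2 ^ n)) (H : 'I_m -> 'M[R[i]]_(2 ^ n)) :
  Hu H0 H (fun=> 0) = H0.
Proof. by rewrite /Hu big1 ?addr0 // => j _; rewrite rmorph0 scale0r. Qed.

Lemma Hu_delta (R : realType) (n m : nat) (H0 : 'M[R[i]]_(2 ^ n)) (H : 'I_m -> 'M[R[i]]_(2 ^ n)) j :
  Hu H0 H (fun k => (k == j)%:R) = H0 + H j.
Proof.
rewrite /Hu (bigD1 j) //= eqxx rmorph1 scale1r big1 ?addr0 // => k /negPf ->.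
by rewrite rmorph0 scale0r.
Qed.

Section Controllability.
Variables (R : realType) (n m : nat).
Local Notation C := R[i].
Local Notation E := 'M[C]_(2 ^ n).
Variables (H0 : E) (H : 'I_m -> E) (gstar : R).
Hypothesis n_gt0 : (1 <= n)%N.
Hypothesis H0_herm : is_hermitian H0.
Hypothesis H_herm : forall j, is_hermitian (H j).
Hypothesis gstar_gt0 : 0 < gstar.
Hypothesis lie_rank : forall A : E,
  lie_generated (fun B => B = iu R *: H0 \/ exists j, B = iu R *: H j) A <-> in_su A.

Local Notation reachable := (reachable_map H0 H gstar).

Let hRS : closed_semigroup reachable :=
  reachable_closed_semigroup n_gt0 H0_herm H_herm gstar_gt0.

(** Two-sided tangency turns the cone into a real vector space; skew-Hermiticity makes the flows in
    both directions dissipative. *)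
Definition ad_tangent (A : E) :=
  [/\ dagger A = - A, tangent reachable (ad A) & tangent reachable (ad (- A))].

Lemma ad_tangent_opp A : ad_tangent A -> ad_tangent (- A).
Proof. by move=> [h1 h2 h3]; split; rewrite ?opprK // daggerN h1 opprK. Qed.

(** The backward flow comes from recurrence, through [flow_opp]. *)
Lemma ad_tangent_flow A : dagger A = - A -> (forall t, 0 <= t -> reachable (flow (ad A) t)) ->
  ad_tangent A.
Proof.
move=> hA h; split=> //; first exact: tangent_of_flow (clin_ad A) h.
apply: (tangent_of_flow (clin_ad _)) => t t0.
have -> : ad (- A) = fun x => - ad A x by apply/funext => x; exact: ad_opp.
apply: (flow_opp hRS (clin_ad A) (dissipative_ad hA) _ h t0).
by move=> x; rewrite ipNr ip_ad // oppr0.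
Qed.

(** A single noiseless piece is the flow of the generator ad (- i H_u); [ad_tangent] is stable under
    the change of sign. *)
Lemma ad_tangent_Hu u : ad_tangent (iu R *: Hu H0 H u).
Proof.
rewrite -[iu R *: _]opprK; apply: ad_tangent_opp.
apply: ad_tangent_flow; first exact: skew_Hu.
move=> t t0; have := reachable_piece H0 H gstar (p := (t, u, false)) t0.
have -> // : piece_flow H0 H gstar (t, u, false) = flow (ad (- (iu R *: Hu H0 H u))) t.
have e : piece_gen H0 H gstar (t, u, false) = ad (- (iu R *: Hu H0 H u)).
  apply/funext => x; rewrite /piece_gen lindblad_genE // mul0r /mixgen scale0r.
  exact: addr0.
by rewrite /piece_flow e.
Qed.

Lemma ad_tangentD A B : ad_tangent A -> ad_tangent B -> ad_tangent (A + B).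
Proof.
move=> [a1 a2 a3] [b1 b2 b3]; have adD X Y (x : E) : ad X x + ad Y x = ad (X + Y) x.
  by rewrite /ad mulmxDl mulmxDr opprD addrACA.
split; first by rewrite daggerD a1 b1 opprD.
  by apply: tangent_ext (tangent_add hRS (clin_ad A) (clin_ad B) a2 b2) => x; rewrite adD.
apply: tangent_ext (tangent_add hRS (clin_ad (- A)) (clin_ad (- B)) a3 b3) => x.
by rewrite adD opprD.
Qed.

Lemma ad_tangentZ_ge0 (r : R) A : 0 <= r -> ad_tangent A -> ad_tangent (r%:C *: A).
Proof.
move=> r0 [a1 a2 a3]; have adZ X (x : E) : r%:C *: ad X x = ad (r%:C *: X) x.
  by rewrite /ad scalerBr scalemxAl scalemxAr.
split; first by rewrite daggerZ conjc_real a1 scalerN.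
  by apply: tangent_ext (tangent_scale hRS r0 a2) => x.
by apply: tangent_ext (tangent_scale hRS r0 a3) => x; rewrite adZ scalerN.
Qed.

Lemma ad_tangentZ (r : R) A : ad_tangent A -> ad_tangent (r%:C *: A).
Proof.
move=> hA; have [r0|r0] := leP 0 r; first exact: ad_tangentZ_ge0.
rewrite -[_ *: A]opprK -scalerN -scaleNr -rmorphN.
by apply: ad_tangentZ_ge0; [rewrite oppr_ge0 ltW|exact: ad_tangent_opp].
Qed.

(** ad is a Lie homomorphism, and the opposite direction is the bracket [B, A]. *)
Lemma ad_tangent_bracket A B : ad_tangent A -> ad_tangent B -> ad_tangent (lie_bracket A B).
Proof.
have adB X Y (x : E) : ad X (ad Y x) - ad Y (ad X x) = ad (lie_bracket X Y) x.
  rewrite /ad /lie_bracket !(mulmxBl, mulmxBr) !mulmxA.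
  by apply/matrixP => i j; rewrite !mxE; ring.
have adN X : (fun x : E => - ad X x) = ad (- X) by apply/funext => x; rewrite ad_opp.
have key X Y : ad_tangent X -> ad_tangent Y -> tangent reachable (ad (lie_bracket X Y)).
  move=> [a1 a2 a3] [b1 b2 b3].
  have dX := dissipative_ad a1.
  have dX' : dissipative (fun x => - ad X x).
    by move=> x; rewrite ipNr ip_ad // oppr0.
  rewrite -!adN in a3 b3.
  by apply: tangent_ext (tangent_bracket hRS (clin_ad X) (clin_ad Y) dX dX' a2 a3 b2 b3) => x.
move=> hA hB; split; last 1 first.
- by have := key _ _ hB hA; rewrite /lie_bracket opprB.
- have [a1 _ _] := hA; have [b1 _ _] := hB.
  by rewrite /lie_bracket daggerB !dagger_mul a1 b1 !mulNmx !mulmxN !opprK opprB.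
- exact: key.
Qed.

(** The [ad_tangent] matrices form a Lie subalgebra containing the generators, hence the whole
    generated algebra. *)
Lemma ad_tangent_su A : in_su A -> ad_tangent A.
Proof.
move=> /lie_rank; apply.
  split; [|exact: ad_tangentD|exact: ad_tangentZ|exact: ad_tangent_bracket].
  by have := ad_tangentZ 0 (ad_tangent_Hu (fun=> 0)); rewrite rmorph0 scale0r.
have h0 : ad_tangent (iu R *: H0) by have := ad_tangent_Hu (fun=> 0); rewrite Hu0.
move=> B [->|[j ->]]; first exact: h0.
(* The drift is always present; i H_j is recovered as the difference of i (H_0 + H_j) and i H_0. *)
have := ad_tangent_Hu (fun k => (k == j)%:R); rewrite Hu_delta scalerDr => h.
by have := ad_tangentD h (ad_tangent_opp h0); rewrite addrAC subrr add0r.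
Qed.

(** Up to a phase, W has a traceless logarithm A, and conjugation by W is exp (ad A). *)
Lemma reachable_unitary (W : E) : unitary W -> reachable (fun x => W *m x *m dagger W).
Proof.
move=> hW; have N0 : (0 < 2 ^ n)%N by rewrite expn_gt0.
have [A hA hfl] := unitary_flow_ad N0 hW.
have [h1 h2 _] := ad_tangent_su hA.
have := flow_of_tangent hRS (clin_ad A) (dissipative_ad h1) h2 ler01.
by have -> : flow (ad A) 1 = fun x => W *m x *m dagger W by apply/funext => x; exact: hfl.
Qed.

(** Noise comes only together with the drift; adding the tangent direction opposite to the drift
    cancels it. *)
Lemma tangent_noise : tangent reachable (mixgen (gstar / 2) (bitflip R n)).
Proof.
pose u0 : 'I_m -> R := fun=> 0.
have t1 : tangent reachable (fun x => ad (- (iu R *: Hu H0 H u0)) x + mixgen (gstar / 2) (bitflip R n) x).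
  apply: tangent_of_flow => [|t t0].
    by apply: clin_add; [exact: clin_ad|exact: clin_mixgen].
  have := reachable_piece H0 H gstar (p := (t, u0, true)) t0.
  by rewrite /piece_flow piece_genE.
have [_ t2 _] := ad_tangent_Hu u0.
have c1 := clin_add (clin_ad (- (iu R *: Hu H0 H u0))) (clin_mixgen (gstar / 2) (bitflip R n)).
apply: tangent_ext (tangent_add hRS c1 (clin_ad _) t1 t2) => x.
by rewrite ad_opp addrAC addNr add0r.
Qed.

(** Pure noise during time t gives the weight (1 - exp (- gstar t)) / 2, which stays below 1 / 2; t
    is obtained by solving for q. *)
Lemma reachable_mix_bitflip q : 0 <= q < 1 / 2 -> reachable (mix q (bitflip R n)).
Proof.
move=> /andP[q0 q1]; have hQ := bitflip_reflection R n_gt0.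
have g0 : 0 <= gstar / 2 by rewrite divr_ge0 // ltW.
pose t := - ln (1 - 2 * q) / gstar.
have t0 : 0 <= t.
  by rewrite divr_ge0 ?(ltW gstar_gt0) // oppr_ge0 ln_le0 // lerBlDr lerDl mulr_ge0.
have := flow_of_tangent hRS (clin_mixgen _ _) (dissipative_mixgen g0 hQ) tangent_noise t0.
have -> // : flow (mixgen (gstar / 2) (bitflip R n)) t = mix q (bitflip R n).
apply/funext => x; rewrite (flow_mixgen x g0 hQ t0); congr (mix _ _ _).
have -> : - (2 * (gstar / 2) * t) = ln (1 - 2 * q) by rewrite /t; field; rewrite gt_eqF.
rewrite lnK ?posrE; last by lra.
by field.
Qed.

(** A unitary similarity turns the bit flip into Q. The weight 1 / 2 is a limit, and a further
    conjugation by Q exchanges q with 1 - q, which reaches the larger weights. *)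
Lemma reachable_mix q Q : 0 <= q <= 1 -> reflection Q -> \tr Q = 0 -> reachable (mix q Q).
Proof.
move=> /andP[q0 q1] hQ tQ; have [_ hcomp _ hclosed] := hRS.
have hX := bitflip_reflection R n_gt0.
have [U hU hd] := reflection_similar hX hQ (etrans (bitflip_trace R n) (esym tQ)).
have small r : 0 <= r < 1 / 2 -> reachable (mix r Q).
  move=> hr.
  have := hcomp _ _ (reachable_unitary hU)
    (hcomp _ _ (reachable_mix_bitflip hr) (reachable_unitary (unitary_dagger hU))).
  have -> // : (fun x => U *m mix r (bitflip R n) (dagger U *m x *m dagger (dagger U)) *m dagger U) = mix r Q.
  apply/funext => x; rewrite /mix daggerK mulmxDr mulmxDl -!scalemxAr -!scalemxAl hd !mulmxA.
  by rewrite (unitaryV hU) mul1mx -(mulmxA x) (unitaryV hU) mulmx1.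
have half : reachable (mix (1 / 2) Q).
  apply: hclosed => e e0; pose d := Num.min (e / 2) (1 / 2).
  have d0 : 0 < d by rewrite lt_min; apply/andP; split; lra.
  have d1 : d <= e / 2 by rewrite ge_min lexx.
  have d2 : d <= 1 / 2 by rewrite ge_min lexx orbT.
  exists (mix (1 / 2 - d) Q); first by apply: small; apply/andP; split; lra.
  move=> x; have -> : mix (1 / 2) Q x - mix (1 / 2 - d) Q x = d%:C *: (Q *m x *m Q - x).
    rewrite /mix; move: (Q *m x *m Q) => y; apply/matrixP => i j; rewrite !mxE.
    by rewrite !rmorphB rmorph1; ring.
  rewrite nrmZR gtr0_norm //; have := nrmB (Q *m x *m Q) x; rewrite nrm_reflection // => h.
  have := ler_wpM2l (ltW d0) h; have := ler_wpM2r (nrm_ge0 x) d1; lra.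
have [ql|qg|->] := ltgtP q (1 / 2); [by apply: small; rewrite q0| |exact: half].
have s := small (1 - q); have h : 0 <= 1 - q < 1 / 2 by apply/andP; split; lra.
have := hcomp _ _ (reachable_unitary (reflection_unitary hQ)) (s h).
have -> // : (fun x => Q *m mix (1 - q) Q x *m dagger Q) = mix q Q.
apply/funext => x; have [hQ1 hQ2] := hQ.
rewrite /mix hQ1 mulmxDr mulmxDl -!scalemxAr -!scalemxAl !mulmxA hQ2 mul1mx.
by rewrite -(mulmxA x) hQ2 mulmx1 addrC opprB addrCA subrr addr0.
Qed.

Lemma reach_closure_of_map (F : E -> E) x : reachable F ->
  mx_closure (reach_set H0 H gstar x) (F x).
Proof.
move=> hF; apply/mx_closure_nrm => e e0.
have D0 : 0 < nrm x + 1 by have := nrm_ge0 x; lra.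
have [ps vp hp] := hF _ (divr_gt0 e0 D0).
exists (run H0 H gstar ps x); first exact: reach_run.
apply: (le_trans (hp x)); rewrite mulrAC ler_pdivrMr // ler_wpM2l ?(ltW e0) //.
by rewrite lerDl.
Qed.

(** Rotate [rho0] to the diagonal of its eigenvalues, act by T-transforms, then rotate into an
    eigenbasis of [rho]. *)
Lemma majorized_reachable (rho0 rho : E) : is_hermitian rho0 -> is_hermitian rho ->
  majorized_by rho rho0 -> exists2 F, reachable F & F rho0 = rho.
Proof.
move=> h0 h [s [s0 [[hs hs0] ss _ hle heq]]].
have [U hU hd] := eigvals_diagonalize h hs.
have [U0 hU0 hd0] := eigvals_diagonalize h0 hs0.
have [_ hcomp _ _] := hRS.
pose P (d : nat -> R) := exists2 F, reachable F & F rho0 = dg (fun k : 'I_(2 ^ n) => d k).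
have evN : ~~ odd (2 ^ n) by rewrite oddX; case: n n_gt0.
have stepP d i j q : (i < 2 ^ n)%N -> (j < 2 ^ n)%N -> i != j -> 0 <= q <= 1 -> P d ->
    P (t_transform i j q d).
  move=> hi hj ij hq [F hF Fd].
  have [||Q [hQ tQ] hmix] := @swap_reflection_exists R _ (Ordinal hi) (Ordinal hj) => //.
  exists (fun x => mix q Q (F x)); first exact: hcomp (reachable_mix hq hQ tQ) hF.
  by rewrite Fd hmix.
have Ps0 : P (fun l => s0`_l).
  exists (fun x => dagger U0 *m x *m dagger (dagger U0)).
    exact: reachable_unitary (unitary_dagger hU0).
  by rewrite daggerK; apply/esym; exact: diag_mx_conj hU0 hd0.
have sdec i j : (i <= j)%N -> (j < 2 ^ n)%N -> s`_j <= s`_i.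
  move=> ij jN; have sz := eigvals_of_size hs.
  apply: (sorted_leq_nth _ _ 0 ss) => //; rewrite ?inE ?sz //; last exact: leq_ltn_trans jN.
  by move=> a b d; exact: (fun x y => le_trans y x).
have [d [F hF Fd] hds] := majorization_t_transform stepP sdec hle heq Ps0.
exists (fun x => U *m F x *m dagger U); first exact: hcomp (reachable_unitary hU) hF.
rewrite Fd hd; congr (_ *m dg _ *m _); apply/funext => k; exact: hds.
Qed.

Lemma run_preserving (FF : E -> R -> Prop) ps x :
  (forall U M c, unitary U -> FF M c -> FF (dagger U *m M *m U) c) ->
  valid ps -> halfspaces FF x -> halfspaces FF (run H0 H gstar ps x).
Proof.
move=> hFF; elim/last_ind: ps => // ps p ih; rewrite /valid all_rcons => /andP[p0 hps] hx.
rewrite run_rcons /piece_flow piece_genE //.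
have [_] := preserving_flow hFF (skew_Hu H0_herm H_herm p.1.2) (piece_rate_ge0 gstar_gt0 p.2)
  (bitflip_reflection R n_gt0) p0.
by apply; exact: ih.
Qed.

End Controllability.

Theorem theorem2 (R : realType) (n m : nat)
  (H0 : 'M[R[i]]_(2 ^ n)) (H : 'I_m -> 'M[R[i]]_(2 ^ n)) (gstar : R) :
  (1 <= n)%N ->
  is_hermitian H0 -> (forall j, is_hermitian (H j)) ->
  0 < gstar ->
  (forall A : 'M[R[i]]_(2 ^ n),
     lie_generated (fun B => B = iu R *: H0 \/ exists j, B = iu R *: H j) A <-> in_su A) ->
  forall rho0 : 'M[R[i]]_(2 ^ n), is_density rho0 ->
  forall rho : 'M[R[i]]_(2 ^ n),
    mx_closure (reach_set H0 H gstar rho0) rho <-> (is_density rho /\ majorized_by rho rho0).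
Proof.
move=> n_gt0 H0_herm H_herm gstar_gt0 lie_rank rho0 hrho0 rho; split; last first.
  (* For a majorized state, a single limit of controlled evolutions carries [rho0] exactly to
     [rho]. *)
  move=> [[h1 _ _] h2]; have [h0 _ _] := hrho0.
  have [F hF <-] := majorized_reachable n_gt0 H0_herm H_herm gstar_gt0 lie_rank h0 h1 h2.
  exact: reach_closure_of_map.
have [h0 _ _] := hrho0.
have [s0 e0 ss0] := sorted_eigvals h0.
move=> /mx_closure_nrm hcl.
(* Reachable states stay in the half-spaces given by the spectrum of [rho0], and so do their
   limits. *)
have hK : halfspaces (spectral_halfspace s0) rho.
  apply: halfspaces_closed => e epos; have [B hB hrB] := hcl e epos; exists B => //.
  have [ps vp ->] := reach_is_run n_gt0 H0_herm H_herm gstar_gt0 hB.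
  apply: run_preserving => //; first by move=> U M c; exact: spectral_halfspace_unitary.
  exact: density_halfspaces.
split; first exact: halfspaces_density hK.
exact: halfspaces_majorized hK.
Qed.
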